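(* Let $\rho\in(0,1)$ and $\theta>0$, and let $\nu_{\rho,\theta}$ be the $\Gamma$-grey measure on $\mathcal{S}'$. For every open, non-empty set $U\subset\mathcal{S}'$ we have $\nu_{\rho,\theta}(U)>0$.
   Context: $\mathcal{S}=\mathcal{S}(\mathbb{R})$ is the space of real-valued Schwartz functions, $\mathcal{S}'$ its topological dual with the strong dual topology, and $\sigma^*$ the $\sigma$-algebra on $\mathcal{S}'$ generated by the cylinder sets (which coincides with the Borel $\sigma$-algebra). $\langle\cdot,\cdot\rangle$ denotes the dual pairing between $\mathcal{S}'$ and $\mathcal{S}$ and, on $\mathcal{S}$, the $L^2(\mathbb{R},dx)$ inner product. The $\Gamma$-grey measure $\nu_{\rho,\theta}$ is the unique probability measure on $(\mathcal{S}',\sigma^* )$ (existing by Bochner-Minlos) with $\int_{\mathcal{S}'}e^{i\langle x,\xi\rangle}\,d\nu_{\rho,\theta}(x)=\Gamma(\rho,\theta+\frac12\langle\xi,\xi\rangle)/\Gamma(\rho,\theta)$ for all $\xi\in\mathcal{S}$, where $\Gamma(\rho,x):=\int_x^{+\infty}e^{-w}w^{\rho-1}\,dw$. *)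

(* Defs.v *)
From HB Require Import structures.
From mathcomp Require Import all_boot all_order all_algebra.
From mathcomp Require Import all_classical all_reals all_analysis.
From mathcomp Require Import complex.

Set Implicit Arguments.
Unset Strict Implicit.
Unset Printing Implicit Defensive.

Import Order.TTheory GRing.Theory Num.Theory.
Import numFieldNormedType.Exports.

Local Open Scope classical_set_scope.
Local Open Scope ring_scope.

Section Schwartz.
Context {R : realType}.
Local Notation "f ^` ( n )" := (derive1n n f) : ring_scope.

Definition smooth (f : R -> R) := forall (n : nat) (x : R), derivable (f^`(n)) x 1.

Definition rapidly_decreasing (f : R -> R) := forall k n : nat,
  exists M : R, forall x : R, `|x ^+ k * f^`(n) x| <= M.

Definition schwartz_pred : {pred R -> R} :=
  mem [set f | smooth f /\ rapidly_decreasing f].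

Record schwartz : Type := Schwartz {
  schwartz_fun :> R -> R ;
  _ : schwartz_fun \in schwartz_pred }.

HB.instance Definition _ := [isSub for schwartz_fun].
HB.instance Definition _ := [Choice of schwartz by <:].

Lemma derive1n_linear (a : R) (f g : R -> R) n : smooth f -> smooth g ->
  (a *: f + g)^`(n) = a *: f^`(n) + g^`(n).
Proof.
move=> sf sg; elim: n => [|n IH]; first by rewrite !derive1n0.
rewrite !derive1nS IH; apply/funext => x.
apply: (etrans (derive1E _ _)); rewrite deriveD//; last exact: derivableZ.
by rewrite deriveZ//; congr (_ *: _ + _); exact/esym/derive1E.
Qed.

Lemma derive1n_cst0 n : (0 : R -> R)^`(n) = 0.
Proof.
elim: n => [|n IH]; first by rewrite derive1n0.
by rewrite derive1nS IH; apply/funext => x; rewrite derive1_cst.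
Qed.

Lemma schwartz_submod_closed : submod_closed schwartz_pred.
Proof.
split.
  rewrite inE/=; split=> [n x|k n].
    by rewrite derive1n_cst0; exact: derivable_cst.
  by exists 0 => x; rewrite derive1n_cst0 mulr0 normr0.
move=> a f g; rewrite !inE/= => -[sf df] [sg dg]; split=> [n x|k n].
  by rewrite derive1n_linear//; apply: derivableD => //; exact: derivableZ.
have [M fM] := df k n; have [N gN] := dg k n.
exists (`|a| * M + N) => x; rewrite derive1n_linear//.
rewrite [X in x ^+ k * X](_ : _ = a * f^`(n) x + g^`(n) x)// mulrDr.
rewrite (le_trans (ler_normD _ _))// lerD// mulrCA normrM.
by rewrite ler_wpM2l.
Qed.

HB.instance Definition _ :=
  GRing.isSubmodClosed.Build _ _ schwartz_pred schwartz_submod_closed.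
HB.instance Definition _ := [SubChoice_isSubLmodule of schwartz by <:].

Definition schwartz_norm (k n : nat) (f : schwartz) : R :=
  sup (range (fun x : R => `|x ^+ k * (f : R -> R)^`(n) x|)).

Definition schwartz_ball (m : nat) (e : R) (f : schwartz) : set schwartz :=
  [set g | forall k n : nat, (k <= m)%N -> (n <= m)%N ->
    schwartz_norm k n (g - f) < e].

(* The balls for finitely many seminorms form a neighbourhood base, so this is
   the locally convex topology generated by the [schwartz_norm k n]. *)
Definition schwartz_open : set_system schwartz :=
  [set A | forall f, A f -> exists m e, 0 < e /\ schwartz_ball m e f `<=` A].

Lemma schwartz_openT : schwartz_open setT.
Proof. by move=> f _; exists 0%N, 1. Qed.

Lemma schwartz_openI : setI_closed schwartz_open.
Proof.
move=> A B oA oB f [Af Bf].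
have [m [e [e0 mA]]] := oA _ Af; have [p [d [d0 pB]]] := oB _ Bf.
exists (maxn m p), (Num.min e d); split; first by rewrite lt_min e0.
move=> g fg; split; [apply: mA|apply: pB] => k n km nm;
  have := fg k n (leq_trans km _) (leq_trans nm _);
  by rewrite ?leq_maxl ?leq_maxr lt_min => /(_ isT isT)/andP[].
Qed.

Lemma schwartz_open_bigU (I : Type) (F : I -> set schwartz) :
  (forall i, schwartz_open (F i)) -> schwartz_open (\bigcup_i F i).
Proof.
move=> oF f [i _ Fif]; have [m [e [e0 mF]]] := oF i _ Fif.
by exists m, e; split => // g /mF Fig; exists i.
Qed.

HB.instance Definition _ := isOpenTopological.Build schwartz
  schwartz_openT schwartz_openI schwartz_open_bigU.

Definition schwartz_inner (f g : schwartz) : R :=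
  \int[lebesgue_measure]_(x in [set: R]) (f x * g x).

(* Absorbed by every neighbourhood of 0 (von Neumann boundedness). *)
Definition vn_bounded (B : set schwartz) : Prop :=
  forall V : set schwartz, nbhs 0 V ->
    exists r : R, 0 < r /\
      forall s : R, r <= `|s| -> B `<=` [set s *: f | f in V].

(* The pairing of x with f is the application [x f]. *)
Record tempered : Type := Tempered {
  tempered_fun :> schwartz -> R ;
  tempered_linear : scalar tempered_fun ;
  tempered_continuous : continuous tempered_fun }.

HB.instance Definition _ := gen_eqMixin tempered.
HB.instance Definition _ := gen_choiceMixin tempered.

Lemma scalar_cst0 : scalar (fun _ : schwartz => 0 : R).
Proof. by move=> a f g /=; rewrite mulr0 addr0. Qed.

Lemma continuous_cst0 : continuous (fun _ : schwartz => 0 : R).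
Proof. exact: cst_continuous. Qed.

HB.instance Definition _ :=
  isPointed.Build tempered (Tempered scalar_cst0 continuous_cst0).

(* The strong topology is that of uniform convergence on bounded sets. *)
HB.instance Definition _ := Topological.copy tempered
  (initial_topology (tempered_fun : tempered -> {family vn_bounded, schwartz -> R})).

(* The Borel sets of R^n are those of the product sigma-algebra on n-tuples. *)
Definition cylinder : set_system tempered :=
  [set C | exists n (xi : 'I_n -> schwartz) (A : set (n.-tuple R)),
    measurable A /\ C = [set x : tempered | A [tuple x (xi i) | i < n]]].

End Schwartz.

Arguments schwartz R : clear implicits.
Arguments tempered R : clear implicits.
Arguments cylinder R : clear implicits.

Notation tempered_measurable R := (g_sigma_algebraType (cylinder R)).

Section GammaGrey.
Context {R : realType}.

Definition expi (t : R) : R[i] := Complex (cos t) (sin t).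

Definition Cintegral d (T : measurableType d)
    (mu : {measure set T -> \bar R}) (f : T -> R[i]) : R[i] :=
  Complex (\int[mu]_(x in [set: T]) complex.Re (f x))
          (\int[mu]_(x in [set: T]) complex.Im (f x)).

Definition upper_gamma (rho x : R) : R :=
  \int[lebesgue_measure]_(w in `[x, +oo[) (expR (- w) * w `^ (rho - 1)).

Definition gamma_grey (rho theta : R)
    (nu : probability (tempered_measurable R) R) : Prop :=
  forall xi : schwartz R,
    Cintegral nu (fun x : tempered R => expi (x xi)) =
    Complex (upper_gamma rho (theta + 2^-1 * schwartz_inner xi xi)
               / upper_gamma rho theta) 0.

End GammaGrey.

(* Main.v *)
(* Let nu be the grey measure.

   Topology.  A bounded subset of S in the (p+1)-th seminorm is totally bounded
   in the p-th one, so S and the dual balls of S' are separable; a strongly open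
   U is then a countable union of dual balls, hence measurable.  By Ehrling's
   inequality and Hahn-Banach, every x in S' is approximated in a dual norm by
   functionals h bounded for the L^2 norm, and countably many such h suffice.
   Consequently the translates of a nonempty open U by countably many
   L^2-bounded h cover S'.

   Quasi-invariance.  The substitution s = e^v in the Laplace representation of
   w^(rho - 1) writes Gamma(rho, theta + x) as a mixture of the functions
   e^(-(1 + e^v) x), so the characteristic functional L of nu is a mixture of
   Gaussian ones of variance at least 1.  A Cameron-Martin type inequality
   for positive definite kernels gives, for a trigonometric polynomial f and
   |h(xi)|^2 <= c |xi|^2,
     (E (f (x + h) + f (x - h)) / 2)^2 <= e^c E f(x)^2.
   Trigonometric polynomials being dense, nu A = 0 implies nu (A - h) = 0.

   If nu U = 0, all the translates above are null and they cover S',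
   contradicting nu S' = 1. *)

Require Import Defs.
From mathcomp Require Import all_boot all_order all_algebra.
From mathcomp Require Import all_classical all_reals all_analysis.
From mathcomp Require Import measurable_realfun ring lra.
Import Order.TTheory GRing.Theory Num.Theory.
Import numFieldNormedType.Exports.
Local Open Scope classical_set_scope.
Local Open Scope ring_scope.

Set Implicit Arguments.
Unset Strict Implicit.
Unset Printing Implicit Defensive.

(** * Hahn-Banach *)

Section HahnBanach.
Context {R : realType} {V : lmodType R}.

(** The obstacle is that [nu] is known only through its characteristic functional, which is not
    Gaussian. The Gaussian mixture is therefore used only at the level of kernels, where
    Cameron-Martin becomes a comparison of quadratic forms. For the Gaussian kernel of variance k
    the constant e^c serves every k >= 1, and this uniformity is what survives the mixing: the
    summand 1 in 1 + e^v keeps the variance away from 0. The hypothesis rho < 1 makes w^(rho - 1)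
    the Laplace transform of a positive density, so that the mixture has positive weights.

    Averaging over h and -h keeps everything real: the average of the two shifts of cos (x xi + a)
    is cos (h xi) cos (x xi + a). Absolute continuity of the translates being the very point at
    issue, closeness to the indicator of A in L^2 of [nu] alone says nothing about them; the
    approximation is made under [nu] and both of its translates at once, with one polynomial.

    On the topological side, each passage between consecutive norms costs one power of x and one
    derivative, which explains the recurrent p and p + 1. *)

Definition sublinear (p : V -> R) :=
  (forall u v, p (u + v) <= p u + p v) /\
  (forall t u, 0 <= t -> p (t *: u) = t * p u).

(** Partial functionals are encoded by their graphs, so that extension is inclusion and Zorn's lemma
    applies to sets. *)
Definition linear_graph (G : set (V * R)) :=
  forall t u v a b, G (u, a) -> G (v, b) -> G (t *: u + v, t * a + b).

Definition graph_below (p : V -> R) (G : set (V * R)) :=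
  forall u a, G (u, a) -> a <= p u.

(** Two values over u put their difference over 0, where it is at most p 0 = 0, in both orders. *)
Lemma graph_below_inj p G u a b : sublinear p -> linear_graph G ->
  graph_below p G -> G (u, a) -> G (u, b) -> a = b.
Proof.
move=> [_ pZ] lG bG Ga Gb.
have H c d : G (u, c) -> G (u, d) -> c <= d.
  move=> Gc Gd; have := bG _ _ (lG (-1) _ _ _ _ Gd Gc).
  by rewrite scaleN1r addNr mulN1r -(scale0r 0) pZ// mul0r; lra.
by apply/eqP; rewrite eq_le !H.
Qed.

(** The value c at v has to satisfy b - p (w - v) <= c <= p (u + v) - a for all pairs of the graph.
    Subadditivity makes every left-hand side at most every right-hand side, and c is the supremum of
    the former. *)
Lemma graph_extend p G v : sublinear p -> linear_graph G -> graph_below p G ->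
  G !=set0 ->
  exists G', [/\ linear_graph G', graph_below p G', G `<=` G' & exists c, G' (v, c)].
Proof.
move=> [pD pZ] lG bG [[u0 a0] G0].
have G00 : G (0, 0).
  by have := lG (-1) _ _ _ _ G0 G0; rewrite scaleN1r mulN1r !addNr.
pose A := [set a.2 - p (a.1 - v) | a in G].
have ub u a : G (u, a) -> ubound A (p (u + v) - a).
  move=> Gua _ [[w b] Gwb <-] /=.
  have := bG _ _ (lG 1 _ _ _ _ Gua Gwb); rewrite scale1r mul1r => h.
  have := pD (u + v) (w - v); rewrite addrACA subrr addr0; lra.
have A0 : A !=set0 by exists (0 - p (0 - v)), (0, 0).
have sA : has_sup A by split => //; exists (p (0 + v) - 0); exact: ub.
pose c := sup A.
have cu u a : G (u, a) -> c <= p (u + v) - a by move=> /ub; exact: ge_sup.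
have cl u a : G (u, a) -> a - p (u - v) <= c.
  by move=> Gua; apply: ub_le_sup; [exact: (proj2 sA)|exists (u, a)].
exists [set z | exists u a t, G (u, a) /\ z = (u + t *: v, a + t * c)]; split.
- move=> t _ _ _ _ [u [a [s [Gua [-> ->]]]]] [w [b [r [Gwb [-> ->]]]]].
  exists (t *: u + w), (t * a + b), (t * s + r); split; first exact: lG.
  congr (_, _); last by ring.
  by rewrite scalerDr scalerA scalerDl addrACA.
- move=> _ _ [u [a [t [Gua [-> ->]]]]].
  have Gs s : G (s *: u, s * a).
    by have := lG s _ _ _ _ Gua G00; rewrite !addr0.
  (* Division by the absolute value of t reduces to the coefficients 1 and -1, governed by the upper
     and the lower bound on c. *)
  have [t0|t0|->] := ltgtP t 0; last first.
  + by rewrite scale0r mul0r !addr0; exact: bG.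
  + have := cu _ _ (Gs t^-1).
    have -> : t^-1 *: u + v = t^-1 *: (u + t *: v).
      by rewrite scalerDr scalerA mulVf ?gt_eqF// scale1r.
    rewrite pZ; last by rewrite invr_ge0 ltW.
    by rewrite -mulrBr mulrC ler_pdivlMr//; lra.
  + have tp : 0 < - t by rewrite oppr_gt0.
    have := cl _ _ (Gs (- t)^-1).
    have -> : (- t)^-1 *: u - v = (- t)^-1 *: (u + t *: v).
      by rewrite scalerDr scalerA invrN mulNr mulVf ?lt_eqF// scaleN1r.
    rewrite pZ; last by rewrite invr_ge0 ltW.
    by rewrite -mulrBr mulrC ler_pdivrMr//; lra.
- by move=> [u a] Gua; exists u, a, 0; rewrite scale0r mul0r !addr0.
- by exists c, 0, 0, 1; rewrite scale1r mul1r !add0r.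
Qed.

Lemma hahn_banach p G0 : sublinear p -> linear_graph G0 -> graph_below p G0 ->
  G0 !=set0 ->
  exists g : V -> R, [/\ scalar g, forall u, g u <= p u &
    forall u a, G0 (u, a) -> g u = a].
Proof.
move=> sp lG0 bG0 G0n.
(* The union with [G0] makes the property hold for the union of the empty chain, which is the empty
   set. *)
pose P (X : set (V * R)) := linear_graph (X `|` G0) /\ graph_below p (X `|` G0).
have [F FP Ft|X [[lX bX] maxX]] := @Zorn_bigcup _ P.
  split.
    move=> t u v a b.
    have H : forall Y Z, F Y -> F Z -> (Y `|` G0) (u, a) -> (Z `|` G0) (v, b) ->
        (\bigcup_(X in F) X `|` G0) (t *: u + v, t * a + b).
      move=> Y Z FY FZ Yu Zv; have [YZ|ZY] := Ft _ _ FY FZ.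
        have [|h|h] := (FP _ FZ).1 t u v a b _ Zv; last by right.
          by case: Yu => [/YZ|]; [left|right].
        by left; exists Z.
      have [|h|h] := (FP _ FY).1 t u v a b Yu; last by right.
        by case: Zv => [/ZY|]; [left|right].
      by left; exists Y.
    move=> [[Y FY Yu]|Gu] [[Z FZ Zv]|Gv].
    - by apply: (H Y Z) => //; left.
    - by apply: (H Y Y) => //; [left|right].
    - by apply: (H Z Z) => //; [right|left].
    - by right; exact: lG0.
  move=> u a [[Y FY Yu]|]; last exact: bG0.
  by apply: (FP _ FY).2; left.
set G := X `|` G0 in lX bX.
have Gn : G !=set0 by case: G0n => z ?; exists z; right.
have tot v : exists a, G (v, a).
  have [G' [lG' bG' GG' [c Gvc]]] := graph_extend v sp lX bX Gn.
  exists c; left; apply: contrapT => nX.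
  have G'G : G' `|` G0 = G' by apply/setUidPl => z ?; apply: GG'; right.
  apply: (maxX G'); last by split; rewrite G'G.
  split; first by move=> z Xz; apply: GG'; left.
  by move=> /(_ _ Gvc).
have [g gG] := choice tot.
have gE u a : G (u, a) -> g u = a.
  by move=> Gua; exact: (graph_below_inj sp lX bX (gG u) Gua).
exists g; split.
- by move=> t u v /=; apply: gE; exact: lX.
- by move=> u; exact: bX.
- by move=> u a G0u; apply: gE; right.
Qed.

End HahnBanach.

(** This turns Ehrling's inequality into an approximation: with p a multiple of the L^2 norm and q a
    small multiple of a Schwartz norm, g is bounded for L^2 and x - g is small. *)
Lemma sublinear_split {R : realType} {V : lmodType R} (p q x : V -> R) :
  sublinear p -> sublinear q ->
  scalar x -> (forall u, x u <= p u + q u) ->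
  exists g, [/\ scalar g, forall u, g u <= p u & forall u, x u - g u <= q u].
Proof.
move=> [pD pZ] [qD qZ] lx xpq.
pose r (z : V * V) := p z.1 + q z.2.
(* extend the functional (u, u) |-> x u from the diagonal of V x V *)
pose D : set ((V * V) * R) := [set ((u, u), x u) | u in setT].
have p0 : p 0 = 0 by rewrite -(scale0r 0) pZ// mul0r.
have q0 : q 0 = 0 by rewrite -(scale0r 0) qZ// mul0r.
have [| | | |F [lF Fr FD]] := @hahn_banach R _ r D.
- split=> [[u1 u2] [v1 v2]|t [u1 u2] t0]; rewrite /r /=.
    by have := pD u1 v1; have := qD u2 v2; lra.
  by rewrite pZ// qZ// mulrDr.
- by move=> t _ _ _ _ [u _ [<- <-]] [v _ [<- <-]]; exists (t *: u + v); rewrite // lx.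
- by move=> _ _ [u _ [<- <-]]; exact: xpq.
- by exists ((0, 0), x 0), 0.
have FE u : x u - F (u, 0) = F (0, u).
  rewrite -(FD (u, u) (x u)); last by exists u.
  have := lF 1 (u, 0) (0, u); rewrite scale1r mul1r => h.
  have -> : (u, u) = (u, 0) + (0, u) :> V * V by congr (_, _); rewrite /= ?addr0 ?add0r.
  by rewrite h; ring.
exists (fun u => F (u, 0)); split=> [t u v|u|u].
- rewrite -lF; congr F; congr (_, _) => /=.
  by rewrite scaler0 addr0.
- by have := Fr (u, 0); rewrite /r /= q0 addr0.
- by rewrite FE; have := Fr (0, u); rewrite /r /= p0 add0r.
Qed.

(** * Seminorms of the Schwartz space *)

Section SchwartzNorms.
Context {R : realType}.
Implicit Types (f g : schwartz R) (k n p : nat).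
Local Notation D n f := (derive1n n (f : R -> R)).

Lemma schwartz_smooth f : smooth f.
Proof. by case: f => f /=; rewrite inE => -[]. Qed.

Lemma schwartz_ubound k n f : exists M, forall x, `|x ^+ k * D n f x| <= M.
Proof. by case: f => f /=; rewrite inE => -[_]; exact. Qed.

Lemma schwartz_has_sup k n f : has_sup (range (fun x => `|x ^+ k * D n f x|)).
Proof.
split; first by exists `|0 ^+ k * D n f 0|, 0.
by have [M fM] := schwartz_ubound k n f; exists M => _ [x _ <-].
Qed.

Lemma schwartz_norm_ub k n f x : `|x ^+ k * D n f x| <= schwartz_norm k n f.
Proof. by apply: (ub_le_sup (proj2 (schwartz_has_sup k n f))); exists x. Qed.

Lemma schwartz_norm_le k n f M : (forall x, `|x ^+ k * D n f x| <= M) ->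
  schwartz_norm k n f <= M.
Proof.
move=> fM; apply: ge_sup; first exact: (proj1 (schwartz_has_sup k n f)).
by move=> _ [x _ <-].
Qed.

Lemma schwartz_norm_ge0 k n f : 0 <= schwartz_norm k n f.
Proof. exact: le_trans (schwartz_norm_ub k n f 0). Qed.

Lemma schwartz_derive_linear a f g n x : D n (a *: f + g) x = a * D n f x + D n g x.
Proof.
by rewrite /= (derive1n_linear _ _ (@schwartz_smooth f) (@schwartz_smooth g)).
Qed.

Lemma schwartz_deriveB f g n x : D n (f - g) x = D n f x - D n g x.
Proof. by rewrite addrC -scaleN1r schwartz_derive_linear mulN1r addrC. Qed.

Lemma schwartz_norm_linear a k n f g :
  schwartz_norm k n (a *: f + g) <= `|a| * schwartz_norm k n f + schwartz_norm k n g.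
Proof.
apply: schwartz_norm_le => x; rewrite schwartz_derive_linear mulrDr mulrCA.
rewrite (le_trans (ler_normD _ _))// lerD ?schwartz_norm_ub// normrM.
by rewrite ler_wpM2l// schwartz_norm_ub.
Qed.

Lemma schwartz_norm0 k n : schwartz_norm k n (0 : schwartz R) = 0.
Proof.
apply/eqP; rewrite eq_le schwartz_norm_ge0 andbT; apply: schwartz_norm_le => x.
by rewrite -[0 : schwartz R](subrr 0) schwartz_deriveB subrr mulr0 normr0.
Qed.

(** An increasing sequence of norms with the same topology as all the [schwartz_norm k n], so that a
    single index replaces a finite family. *)
Definition schwartz_sum p f : R :=
  \sum_(k < p.+1) \sum_(n < p.+1) schwartz_norm k n f.

Lemma schwartz_sum_ge0 p f : 0 <= schwartz_sum p f.
Proof. by do 2 apply: sumr_ge0 => ? _; exact: schwartz_norm_ge0. Qed.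

Lemma schwartz_norm_le_sum p k n f : (k <= p)%N -> (n <= p)%N ->
  schwartz_norm k n f <= schwartz_sum p f.
Proof.
rewrite -[(k <= p)%N]ltnS -[(n <= p)%N]ltnS => kp np.
rewrite /schwartz_sum (bigD1 (Ordinal kp))//= (bigD1 (Ordinal np))//= -addrA.
rewrite lerDl addr_ge0// sumr_ge0// => i _; last apply: sumr_ge0 => j _;
  exact: schwartz_norm_ge0.
Qed.

Lemma schwartz_le_sum p k n f x : (k <= p)%N -> (n <= p)%N ->
  `|x ^+ k * D n f x| <= schwartz_sum p f.
Proof.
by move=> kp np; exact: le_trans (schwartz_norm_ub _ _ _ _) (schwartz_norm_le_sum _ kp np).
Qed.

Lemma schwartz_sum_le_const p f C :
  (forall k n, (k <= p)%N -> (n <= p)%N -> schwartz_norm k n f <= C) ->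
  schwartz_sum p f <= (p.+1 * p.+1)%:R * C.
Proof.
move=> fC; rewrite /schwartz_sum.
apply: (@le_trans _ _ (\sum_(k < p.+1) \sum_(n < p.+1) C)).
  by do 2 apply: ler_sum => ? _; apply: fC; rewrite -ltnS.
by rewrite !sumr_const !card_ord -mulrnA mulr_natl.
Qed.

Lemma schwartz_sum_linear a p f g :
  schwartz_sum p (a *: f + g) <= `|a| * schwartz_sum p f + schwartz_sum p g.
Proof.
rewrite /schwartz_sum mulr_sumr -big_split; apply: ler_sum => k _ /=.
by rewrite mulr_sumr -big_split; apply: ler_sum => n _; exact: schwartz_norm_linear.
Qed.

Lemma schwartz_sum0 p : schwartz_sum p 0 = 0.
Proof. by rewrite /schwartz_sum; do 2 apply: big1 => ? _; exact: schwartz_norm0. Qed.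

Lemma schwartz_sumZ a p f : schwartz_sum p (a *: f) = `|a| * schwartz_sum p f.
Proof.
have le b h : schwartz_sum p (b *: h) <= `|b| * schwartz_sum p h.
  by have := schwartz_sum_linear b p h 0; rewrite schwartz_sum0 !addr0.
have [->|a0] := eqVneq a 0; first by rewrite scale0r schwartz_sum0 normr0 mul0r.
apply/eqP; rewrite eq_le le /= -ler_pdivlMl ?normr_gt0//.
by have := le a^-1 (a *: f); rewrite scalerA mulVf// scale1r normfV.
Qed.

Lemma schwartz_sumD p f g : schwartz_sum p (f + g) <= schwartz_sum p f + schwartz_sum p g.
Proof. by have := schwartz_sum_linear 1 p f g; rewrite scale1r normr1 mul1r. Qed.

Lemma schwartz_sumB p f g : schwartz_sum p (f - g) <= schwartz_sum p f + schwartz_sum p g.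
Proof.
by rewrite (le_trans (schwartz_sumD _ _ _))// -scaleN1r schwartz_sumZ normrN1 mul1r.
Qed.

Lemma schwartz_sum_mono p q f : (p <= q)%N -> schwartz_sum p f <= schwartz_sum q f.
Proof.
move=> pq; rewrite /schwartz_sum.
have h (u : nat -> R) : (forall i, 0 <= u i) ->
    \sum_(i < p.+1) u i <= \sum_(i < q.+1) u i.
  move=> u0; rewrite -(big_mkord xpredT) -(big_mkord xpredT u).
  by rewrite [leRHS](@big_cat_nat _ _ _ p.+1)//= lerDl sumr_ge0.
apply: (@le_trans _ _ (\sum_(k < p.+1) \sum_(n < q.+1) schwartz_norm k n f)).
  by apply: ler_sum => k _; apply: (h (fun n => schwartz_norm k n f)) => n; exact: schwartz_norm_ge0.
apply: (h (fun k => \sum_(n < q.+1) schwartz_norm k n f)) => k.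
by apply: sumr_ge0 => n _; exact: schwartz_norm_ge0.
Qed.

Lemma schwartz_sublinear p : sublinear (@schwartz_sum p).
Proof.
split=> [f g|t f t0]; first exact: schwartz_sumD.
by rewrite schwartz_sumZ ger0_norm.
Qed.

Lemma schwartz_is_derive n f (x : R) : is_derive x (1 : R) (D n f) (D n.+1 f x).
Proof. by rewrite derive1nS derive1E; apply: DeriveDef => //; exact: schwartz_smooth. Qed.

Lemma schwartz_derive_cont n f : continuous (D n f).
Proof.
move=> x; apply: differentiable_continuous; apply/derivable1_diffP.
exact: schwartz_smooth.
Qed.

Lemma schwartz_continuous f : continuous f.
Proof. by rewrite -[X in continuous X]derive1n0; exact: schwartz_derive_cont. Qed.

Lemma schwartz_MVT n f (a b : R) : a < b ->
  exists2 c, c \in `]a, b[ & D n f b - D n f a = D n.+1 f c * (b - a).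
Proof.
move=> ab; apply: MVT => // [x _|]; first exact: schwartz_is_derive.
exact/continuous_subspaceT/schwartz_derive_cont.
Qed.

Lemma schwartz_lipschitz n f (a b : R) :
  `|D n f b - D n f a| <= schwartz_norm 0 n.+1 f * `|b - a|.
Proof.
wlog ab : a b / a < b => [wl|].
  have [|ba|->] := ltgtP a b; first exact: wl.
    by rewrite distrC [in leRHS]distrC; exact: wl.
  by rewrite !subrr normr0 mulr0.
have [c _ ->] := schwartz_MVT n f ab; rewrite normrM ler_wpM2r//.
by have := schwartz_norm_ub 0 n.+1 f c; rewrite expr0 mul1r.
Qed.

(** One more power of x, available in the norm of index p + 1, gains the factor 1 / a far from the
    origin. *)
Lemma schwartz_tail p k n f (a x : R) : 0 < a -> a <= `|x| -> (k <= p)%N -> (n <= p)%N ->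
  `|x ^+ k * D n f x| <= schwartz_sum p.+1 f / a.
Proof.
move=> a0 ax kp np; rewrite ler_pdivlMr//.
rewrite (le_trans _ (schwartz_le_sum f x (_ : (k.+1 <= p.+1)%N) (leqW np)))//.
by rewrite exprS -mulrA [leRHS]normrM mulrC ler_wpM2r.
Qed.

End SchwartzNorms.

(** * Total boundedness of the balls of one Schwartz norm for the preceding one *)

Lemma finite_representatives (T : choiceType) (K : finType) (tab : T -> K) (P : set T) :
  exists F : seq T, forall f, P f -> exists g, [/\ g \in F, P g & tab g = tab f].
Proof.
have [[f0 _]|nP] := pselect (P !=set0); last first.
  by exists [::] => f Pf; exfalso; apply: nP; exists f.
exists [seq xget f0 [set g | P g /\ tab g = k] | k <- enum K] => f Pf.
have [] := @xgetPex _ f0 [set g | P g /\ tab g = tab f]; first by exists f.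
set g := xget _ _ => Pg tg; exists g; split => //.
by apply/mapP; exists (tab f); rewrite ?mem_enum.
Qed.

Section TotallyBounded.
Context {R : realType}.
Implicit Types (f g : schwartz R) (k n p : nat).
Local Notation D n f := (derive1n n (f : R -> R)).

(** The shift by M makes the arguments nonnegative, where [Num.truncn] is the integer part. *)
Lemma truncn_close (m : nat) (M y z : R) : (0 < m)%N -> `|y| <= M -> `|z| <= M ->
  Num.truncn (m%:R * (y + M)) = Num.truncn (m%:R * (z + M)) ->
  `|y - z| <= m%:R^-1.
Proof.
move=> m0 yM zM e; have m0' : 0 < m%:R :> R by rewrite ltr0n.
have h w : `|w| <= M -> 0 <= m%:R * (w + M).
  by rewrite ler_norml => /andP[? _]; rewrite mulr_ge0//; lra.
have /andP[y1 y2] := truncn_itv (h _ yM).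
have /andP[z1 z2] := truncn_itv (h _ zM).
rewrite e in y1 y2; rewrite -natr1 in y2 z2.
rewrite -[leRHS]mul1r ler_pdivlMr// -[m%:R in leLHS]gtr0_norm// -normrM ler_norml.
by apply/andP; split; nra.
Qed.

(** Outside [-a, a] the extra power of x makes u small. Inside, the grid point just to the left of x
    is at distance at most 1 / m, and the extra derivative gives a Lipschitz constant M. *)
Lemma schwartz_small_of_grid (a m p : nat) (M : R) (u : schwartz R) :
  (0 < a)%N -> (0 < m)%N -> schwartz_sum p.+1 u <= M ->
  (forall n i, (n <= p)%N -> (i <= (a + a) * m)%N ->
     `|D n u (- a%:R + i%:R / m%:R)| <= m%:R^-1) ->
  schwartz_sum p u <= (p.+1 * p.+1)%:R * Num.max (M / a%:R) (a%:R ^+ p * ((1 + M) / m%:R)).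
Proof.
move=> a0 m0 uM grid; have a0' : 0 < a%:R :> R by rewrite ltr0n.
have m0' : 0 < m%:R :> R by rewrite ltr0n.
have a1 : 1 <= a%:R :> R by rewrite ler1n.
apply: schwartz_sum_le_const => k n kp np; apply: schwartz_norm_le => x.
rewrite le_max; have [ax|xa] := leP a%:R `|x|.
  rewrite (le_trans (schwartz_tail _ a0' ax kp np))//.
  by rewrite ler_pM2r ?invr_gt0.
apply/orP; right; rewrite normrM ler_pM//.
  rewrite normrX (le_trans (lerXn2r _ _ _ (ltW xa))) ?nnegrE//.
  by rewrite ler_weXn2l.
have /andP[xa1 xa2] : - a%:R < x < a%:R by rewrite -ltr_norml.
pose i := Num.truncn ((x + a%:R) * m%:R).
have xm0 : 0 <= (x + a%:R) * m%:R by rewrite mulr_ge0//; lra.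
have /andP[i1 i2] := truncn_itv xm0; rewrite -/i -natr1 in i1 i2.
have im : (i <= (a + a) * m)%N.
  rewrite -(ler_nat R) natrM natrD (le_trans i1)// ler_pM2r//; lra.
pose t : R := - a%:R + i%:R / m%:R.
have tx : `|x - t| <= m%:R^-1.
  rewrite -[leRHS]mul1r ler_pdivlMr// -[m%:R in leLHS]gtr0_norm// -normrM.
  rewrite /t mulrBl mulrDl -mulrA mulVf ?gt_eqF// mulr1 ler_norml.
  by apply/andP; split; lra.
have -> : D n u x = D n u t + (D n u x - D n u t) by rewrite addrC subrK.
rewrite (le_trans (ler_normD _ _))// mulrDl mul1r lerD ?grid//.
rewrite (le_trans (schwartz_lipschitz _ _ _ _))// ler_pM ?schwartz_norm_ge0//.
by rewrite (le_trans _ uM)// schwartz_norm_le_sum.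
Qed.

Lemma schwartz_totally_bounded p (M e : R) : 0 < e ->
  exists F : seq (schwartz R), forall f, schwartz_sum p.+1 f <= M ->
    exists g, [/\ g \in F, schwartz_sum p.+1 g <= M & schwartz_sum p (f - g) <= e].
Proof.
move=> e0; have [M0|M0] := ltP M 0.
  by exists [::] => f fM; move: (schwartz_sum_ge0 p.+1 f); rewrite leNgt (le_lt_trans fM).
pose P : R := (p.+1 * p.+1)%:R; have P0 : 0 < P by rewrite ltr0n.
have large (c : R) : exists2 a : nat, (0 < a)%N & P * (c / a%:R) <= e.
  exists (Num.truncn (P * `|c| / e)).+1 => //.
  rewrite mulrA ler_pdivrMr ?ltr0n// [leRHS]mulrC -ler_pdivrMr//.
  rewrite (le_trans _ (ltW (truncnS_gt _)))// ler_pM2r ?invr_gt0// ler_pM2l//.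
  exact: ler_norm.
(* The bound M + M is the one for a difference of two elements of the ball. The window a is fixed
   before the mesh m, which has to beat a^p. *)
have [a a0 aP] := large (M + M).
have [m m0 mP] := large (a%:R ^+ p * (1 + (M + M))).
(* Functions are classified by the rounded values of their derivatives of order at most p on the
   grid; two functions of the same class differ there by at most 1 / m. *)
pose K : finType := {ffun 'I_p.+1 * 'I_((a + a) * m).+1 -> 'I_(Num.truncn (m%:R * (M + M))).+1}.
pose tab f : K := [ffun z : 'I_p.+1 * 'I_((a + a) * m).+1 => inord (Num.truncn (m%:R * (D z.1 f (- a%:R + z.2%:R / m%:R) + M)))].
have [F FP] := finite_representatives tab [set f | schwartz_sum p.+1 f <= M].
exists F => f fM; have [g [gF gM tabE]] := FP f fM; exists g; split => //.
have small (h : schwartz R) n t : (n <= p)%N -> schwartz_sum p.+1 h <= M -> `|D n h t| <= M.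
  move=> np hM; have := schwartz_le_sum h t (leq0n p.+1) (leqW np).
  by rewrite expr0 mul1r => /le_trans; exact.
have uM : schwartz_sum p.+1 (f - g) <= M + M.
  by rewrite (le_trans (schwartz_sumB _ _ _))// lerD.
rewrite (le_trans (schwartz_small_of_grid a0 m0 uM _))//.
  move=> n i np im; rewrite schwartz_deriveB; set t := - a%:R + _.
  apply: (@truncn_close m M) => //; [exact: small|exact: small|].
  have /ffunP/(_ (inord n, inord i)) := tabE; rewrite !ffunE/= !inordK ?ltnS// -/t.
  move=> /(congr1 val) /=; rewrite !inordK ?ltnS//; rewrite ?le_truncn//.
  - by rewrite ler_wpM2l// lerD2r (le_trans (ler_norm _))// small.
  - by rewrite ler_wpM2l// lerD2r (le_trans (ler_norm _))// small.
by rewrite -/P /Num.max; case: ifP => _ //; rewrite [X in P * X]mulrA.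
Qed.
End TotallyBounded.

(** * L^2 theory and Ehrling's inequality *)

Section RintegralSum.
Context d {T : measurableType d} {R : realType} (mu : {measure set T -> \bar R}).

Lemma integrable_sum_EFin (I : Type) (s : seq I) (F : I -> T -> R) :
  (forall i, mu.-integrable setT (EFin \o F i)) ->
  mu.-integrable setT (EFin \o (fun x => \sum_(i <- s) F i x)).
Proof.
move=> iF; rewrite (_ : _ \o _ = (fun x => \sum_(i <- s) (F i x)%:E)%E).
  by apply: integrable_sum => // i _; exact: iF.
by apply/funext => x /=; rewrite sumEFin.
Qed.

Lemma integrableZl_EFin (a : R) (f : T -> R) : mu.-integrable setT (EFin \o f) ->
  mu.-integrable setT (EFin \o (fun x => a * f x)).
Proof.
by move=> fi; rewrite (_ : _ \o _ = fun x => (a%:E * (EFin \o f) x)%E)//; exact: integrableZl.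
Qed.

Lemma Rintegral_sum (I : Type) (s : seq I) (F : I -> T -> R) :
  (forall i, mu.-integrable setT (EFin \o F i)) ->
  \int[mu]_x (\sum_(i <- s) F i x) = \sum_(i <- s) \int[mu]_x F i x.
Proof.
move=> iF; elim: s => [|i s IH].
  rewrite big_nil (@eq_Rintegral _ _ _ _ _ (cst 0)); last by move=> x _; rewrite big_nil.
  by rewrite Rintegral_cst// mul0r.
rewrite big_cons -IH -RintegralD//; last exact: integrable_sum_EFin.
by apply: eq_Rintegral => x _; rewrite big_cons.
Qed.

End RintegralSum.

Section SchwartzL2.
Context {R : realType}.
Implicit Types (f g h : schwartz R) (k n p : nat).
Local Notation D n f := (derive1n n (f : R -> R)).
Local Notation mu := (@lebesgue_measure R).

Lemma integrable_oneDsqrV : mu.-integrable setT (EFin \o (fun x : R => (oneDsqr x)^-1)).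
Proof.
apply/integrableP; split.
  apply/measurable_EFinP; apply: continuous_measurable_fun.
  exact: continuous_oneDsqrV.
have -> : (\int[mu]_x `|(EFin \o (fun x : R => (oneDsqr x)^-1)%R) x| = \int[mu]_x ((oneDsqr x)^-1)%R%:E)%E.
  apply: eq_integral.
  by move=> x _; rewrite /= ger0_norm// invr_ge0 (le_trans _ (oneDsqr_ge1 x)).
rewrite (ge0_symfun_integralT (f := fun x : R => (oneDsqr x)^-1)).
- by rewrite -set_itvcy integral0y_oneDsqr -EFinM ltry.
- by move=> x; rewrite invr_ge0 (le_trans _ (oneDsqr_ge1 x)).
- exact: continuous_oneDsqrV.
- by move=> x; rewrite /oneDsqr /= sqrrN.
Qed.

Lemma schwartz_mul_le f g (x : R) :
  `|f x * g x| <= 2 * schwartz_sum 1 f * schwartz_sum 1 g * (oneDsqr x)^-1.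
Proof.
have o1 := oneDsqr_ge1 x.
rewrite ler_pdivlMr ?(lt_le_trans _ o1)// /oneDsqr mulrDr mulr1.
have h (u : schwartz R) : `|u x| <= schwartz_sum 1 u /\ `|x * u x| <= schwartz_sum 1 u.
  have := schwartz_le_sum (p := 1) (k := 0) (n := 0) u x isT isT.
  have := schwartz_le_sum (p := 1) (k := 1) (n := 0) u x isT isT.
  by rewrite expr0 expr1 mul1r.
have [f0 f1] := h f; have [g0 g1] := h g.
have -> : `|f x * g x| * x ^+ 2 = `|x * f x| * `|x * g x|.
  by rewrite -normrM -{1}(ger0_norm (sqr_ge0 x)) -normrM; congr `|_|; ring.
by rewrite normrM -mulrA mulr_natl mulr2n lerD// ler_pM.
Qed.

Lemma schwartz_mul_integrable f g : mu.-integrable setT (EFin \o (fun x => f x * g x)).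
Proof.
have := integrableZl_EFin (2 * schwartz_sum 1 f * schwartz_sum 1 g) integrable_oneDsqrV.
apply: le_integrable => //.
  apply/measurable_EFinP; apply: continuous_measurable_fun => x.
  by apply: cvgM; [exact: schwartz_continuous|exact: schwartz_continuous].
move=> x _ /=; rewrite lee_fin (le_trans (schwartz_mul_le _ _ _))//.
exact: ler_norm.
Qed.

Lemma schwartz_innerC f g : schwartz_inner f g = schwartz_inner g f.
Proof. by apply: eq_Rintegral => x _; rewrite mulrC. Qed.

Lemma schwartz_inner_linear a f g h :
  schwartz_inner (a *: f + g) h = a * schwartz_inner f h + schwartz_inner g h.
Proof.
rewrite /schwartz_inner -RintegralZl//; last exact: schwartz_mul_integrable.
rewrite -RintegralD//; last 2 first.
- exact: integrableZl_EFin (schwartz_mul_integrable _ _).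
- exact: schwartz_mul_integrable.
apply: eq_Rintegral => x _ /=.
by rewrite [X in X * _ = _](_ : _ = a * f x + g x)// mulrDl mulrA.
Qed.

Lemma schwartz_innerD f g h :
  schwartz_inner (f + g) h = schwartz_inner f h + schwartz_inner g h.
Proof. by rewrite -[f]scale1r schwartz_inner_linear mul1r scale1r. Qed.

Lemma schwartz_inner0 h : schwartz_inner 0 h = 0.
Proof. by have := schwartz_innerD 0 0 h; rewrite addr0; lra. Qed.

Lemma schwartz_innerZ a f h : schwartz_inner (a *: f) h = a * schwartz_inner f h.
Proof. by rewrite -[a *: f]addr0 schwartz_inner_linear schwartz_inner0 addr0. Qed.

Lemma schwartz_inner_ge0 f : 0 <= schwartz_inner f f.
Proof. by apply: Rintegral_ge0 => x _; rewrite -expr2 sqr_ge0. Qed.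

Lemma schwartz_inner_sumB a f g :
  schwartz_inner (a *: f + g) (a *: f + g) =
  a ^+ 2 * schwartz_inner f f + 2 * a * schwartz_inner f g + schwartz_inner g g.
Proof.
rewrite schwartz_inner_linear !(schwartz_innerC _ (_ + _)) !schwartz_inner_linear.
by rewrite (schwartz_innerC g f); ring.
Qed.

Lemma schwartz_cauchy_schwarz f g :
  schwartz_inner f g ^+ 2 <= schwartz_inner f f * schwartz_inner g g.
Proof.
set b := schwartz_inner f g; set c := schwartz_inner g g.
have H t := schwartz_inner_ge0 (t *: f + g).
have {}H t : 0 <= t ^+ 2 * schwartz_inner f f + 2 * t * b + c.
  by rewrite -schwartz_inner_sumB.
have := schwartz_inner_ge0 f; set a := schwartz_inner f f in H *.
rewrite le_eqVlt => /predU1P[a0|a0].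
  rewrite -a0 mul0r; have [->|b0] := eqVneq b 0; first by rewrite expr0n.
  (* With vanishing leading coefficient the quadratic is affine in t, and at this t it equals -1. *)
  have := H (- (c + 1) / (2 * b)); rewrite -a0 mulr0 add0r.
  have -> : 2 * (- (c + 1) / (2 * b)) * b = - (c + 1) by field.
  lra.
have := H (- b / a).
have -> : (- b / a) ^+ 2 * a + 2 * (- b / a) * b + c = (a * c - b ^+ 2) / a.
  by field; rewrite gt_eqF.
by rewrite pmulr_lge0 ?invr_gt0// subr_ge0.
Qed.

Definition l2norm f : R := Num.sqrt (schwartz_inner f f).

Lemma sqr_l2norm f : l2norm f ^+ 2 = schwartz_inner f f.
Proof. by rewrite sqr_sqrtr// schwartz_inner_ge0. Qed.

Lemma l2norm_ge0 f : 0 <= l2norm f. Proof. exact: sqrtr_ge0. Qed.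

Lemma l2norm_sublinear (K : R) : 0 <= K -> sublinear (fun f => K * l2norm f).
Proof.
move=> K0; split=> [f g|t f t0]; last first.
  rewrite /l2norm schwartz_innerZ schwartz_innerC schwartz_innerZ mulrA.
  by rewrite -expr2 sqrtrM ?sqr_ge0// sqrtr_sqr ger0_norm// mulrCA.
rewrite -mulrDr ler_wpM2l// -(ler_pXn2r (n := 2))// ?nnegrE ?addr_ge0 ?l2norm_ge0//.
rewrite sqrrD !sqr_l2norm -[f]scale1r schwartz_inner_sumB scale1r expr1n mul1r mulr1.
suff : schwartz_inner f g <= l2norm f * l2norm g by rewrite mulr2n; lra.
rewrite (le_trans (ler_norm _))// -sqrtr_sqr /l2norm -sqrtrM ?schwartz_inner_ge0//.
by rewrite ler_wsqrtr// schwartz_cauchy_schwarz.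
Qed.

Lemma l2norm_le_sum : exists2 C : R, 0 <= C & forall f, l2norm f <= C * schwartz_sum 1 f.
Proof.
pose A : R := \int[mu]_x (oneDsqr x)^-1.
have A0 : 0 <= A.
  by apply: Rintegral_ge0 => x _; rewrite invr_ge0 (le_trans _ (oneDsqr_ge1 x)).
exists (Num.sqrt (2 * A)) => [|f]; first exact: sqrtr_ge0.
rewrite /l2norm -[X in _ * X](ger0_norm (schwartz_sum_ge0 1 f)) -sqrtr_sqr.
rewrite -sqrtrM ?mulr_ge0// ler_wsqrtr//.
rewrite [leRHS](_ : _ = (2 * schwartz_sum 1 f * schwartz_sum 1 f) * A); last by ring.
rewrite -RintegralZl//; last exact: integrable_oneDsqrV.
apply: le_Rintegral => //; first exact: schwartz_mul_integrable.
  exact: integrableZl_EFin integrable_oneDsqrV.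
by move=> x _; rewrite (le_trans (ler_norm _))// schwartz_mul_le.
Qed.

(** The interval has length e^2 so that its square root contributes the factor e. *)
Lemma l2norm_ge_local f (x e c : R) : 0 < e -> 0 <= c ->
  (forall t, t \in `[x, x + e ^+ 2] -> c <= `|f t|) -> e * c <= l2norm f.
Proof.
move=> e0 c0 fc; rewrite -(ler_pXn2r (n := 2)) ?nnegrE ?l2norm_ge0 ?(mulr_ge0 (ltW e0) c0)//.
rewrite sqr_l2norm exprMn.
have xe : x < x + e ^+ 2 by rewrite ltrDl exprn_gt0.
have mI : measurable (`[x, x + e ^+ 2]%classic : set R) by exact: measurable_itv.
have muI : mu `[x, x + e ^+ 2]%classic = (e ^+ 2)%:E.
  by rewrite lebesgue_measure_itv/= lte_fin xe -EFinD addrAC subrr add0r.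
have -> : e ^+ 2 * c ^+ 2 = \int[mu]_(t in `[x, x + e ^+ 2]%classic) (c ^+ 2).
  by rewrite Rintegral_cst//= muI mulrC.
rewrite Rintegral_mkcond /schwartz_inner.
apply: le_Rintegral => //; last 2 first.
- exact: schwartz_mul_integrable.
- move=> t _; rewrite patchE; case: ifPn => [/set_mem tI|_]; last first.
    by rewrite -expr2 sqr_ge0.
  by rewrite -expr2 -(real_normK (num_real (f t))) ler_pXn2r ?nnegrE// fc.
rewrite -restrict_EFin; apply/integrable_restrict => //=; rewrite setTI.
apply: measurable_bounded_integrable => //; first by have := ltry (e ^+ 2); rewrite -muI.
exact: bounded_cst.
Qed.

Lemma ehrling_derive n (e : R) : 0 < e ->
  exists2 K, 0 <= K & forall f,
    schwartz_norm 0 n f <= K * l2norm f + e * schwartz_norm 0 n.+1 f.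
Proof.
elim: n e => [|n IH] e e0.
  have s0 : 0 < Num.sqrt e by rewrite sqrtr_gt0.
  exists (Num.sqrt e)^-1 => [|f]; first by rewrite invr_ge0 ltW.
  apply: schwartz_norm_le => x; rewrite expr0 mul1r derive1n0.
  set s1 := schwartz_norm 0 1 f.
  have [fx|fx] := leP (`|f x|) (e * s1).
    by rewrite (le_trans fx)// lerDr mulr_ge0 ?l2norm_ge0// invr_ge0 ltW.
  rewrite -lerBlDr -ler_pdivrMl ?invr_gt0// invrK.
  (* By the Lipschitz bound, f stays above |f x| - e s1 in absolute value on the interval of length
     e to the right of x. *)
  apply: (@l2norm_ge_local _ x) => //; first by rewrite subr_ge0 ltW.
  move=> t; rewrite sqr_sqrtr ?(ltW e0)// in_itv/= => /andP[xt tx].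
  have := schwartz_lipschitz 0 f x t; rewrite !derive1n0 -/s1 [`|t - x|]ger0_norm ?subr_ge0// => ft.
  have h : s1 * (t - x) <= e * s1.
    by rewrite mulrC ler_wpM2r ?schwartz_norm_ge0//; lra.
  have := lerB_dist (f x) (f t); rewrite distrC; lra.
(* The factor 4 / e in [step] turns e / 8 into 1 / 2, so that half of [s1] is absorbed by the
   left-hand side; doubling the rest gives 8 / e times K. *)
have [K K0 HK] := IH (e / 8) (divr_gt0 e0 (ltr0Sn R 7)).
exists (8 / e * K) => [|f]; first by rewrite mulr_ge0// divr_ge0// ltW.
set s1 := schwartz_norm 0 n.+1 f; set s2 := schwartz_norm 0 n.+2 f.
(* A Landau-Kolmogorov bound: within e / 2 of x, the mean value theorem provides a point where the
   derivative is a difference quotient. *)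
have step : s1 <= 4 / e * schwartz_norm 0 n f + e / 2 * s2.
  apply: schwartz_norm_le => x; rewrite expr0 mul1r.
  have xe : x < x + e / 2 by rewrite ltrDl divr_gt0.
  have [c] := schwartz_MVT n f xe; rewrite in_itv/= addrAC subrr add0r => /andP[xc cx] E.
  have := schwartz_lipschitz n.+1 f x c; rewrite -/s2 [`|c - x|]ger0_norm; last by lra.
  have h : s2 * (c - x) <= e / 2 * s2.
    by rewrite mulrC ler_wpM2r ?schwartz_norm_ge0//; lra.
  have b y : `|D n f y| <= schwartz_norm 0 n f.
    by have := schwartz_norm_ub 0 n f y; rewrite expr0 mul1r.
  have Dc : `|D n.+1 f c| <= 4 / e * schwartz_norm 0 n f.
    have -> : D n.+1 f c = (D n f (x + e / 2) - D n f x) * (2 / e).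
      by rewrite E -derive1nS; field; rewrite gt_eqF.
    rewrite normrM [`|2 / e|]ger0_norm ?divr_ge0 ?(ltW e0)//.
    have -> : 4 / e * schwartz_norm 0 n f = (schwartz_norm 0 n f + schwartz_norm 0 n f) * (2 / e).
      by field; rewrite gt_eqF.
    rewrite ler_pM2r ?divr_gt0//.
    by rewrite (le_trans (ler_normB _ _))// lerD.
  have := lerB_dist (D n.+1 f x) (D n.+1 f c); rewrite distrC; lra.
have := HK f; rewrite -/s1 => h.
have : 4 / e * schwartz_norm 0 n f <= 4 / e * (K * l2norm f + e / 8 * s1).
  by rewrite ler_pM2l// divr_gt0.
have -> : 4 / e * (K * l2norm f + e / 8 * s1) = (8 / e * K * l2norm f + s1) / 2.
  by field; rewrite gt_eqF.
lra.
Qed.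

(** For |x| >= a the tail costs 1 / a; for |x| < a the weight is at most a^p and the unweighted
    inequality applies with parameter d. The choices of a and d make each contribution at most e / 2
    after multiplication by the number P of seminorms; the summand 1 in a ensures a^k <= a^p. *)
Lemma schwartz_ehrling p (e : R) : 0 < e ->
  exists2 K, 0 <= K & forall f,
    schwartz_sum p f <= K * l2norm f + e * schwartz_sum p.+1 f.
Proof.
move=> e0; pose P : R := (p.+1 * p.+1)%:R; have P0 : 0 < P by rewrite ltr0n.
pose a : R := 2 * P / e + 1.
have a0 : 0 < a by rewrite ltr_wpDl// divr_ge0 ?mulr_ge0 ?(ltW e0) ?(ltW P0).
have a1 : 1 <= a by rewrite lerDr divr_ge0 ?mulr_ge0 ?(ltW e0) ?(ltW P0).
pose d := e / (2 * P * a ^+ p).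
have d0 : 0 < d by rewrite divr_gt0// !mulr_gt0// exprn_gt0.
have /choice[K HK] : forall n, exists K, 0 <= K /\ forall f,
    schwartz_norm 0 n f <= K * l2norm f + d * schwartz_norm 0 n.+1 f.
  by move=> n; have [K K0 HK] := ehrling_derive n d0; exists K.
pose L := \sum_(n < p.+1) K n.
have L0 : 0 <= L by apply: sumr_ge0 => n _; exact: (HK n).1.
have KL n : (n <= p)%N -> K n <= L.
  rewrite -ltnS => np; rewrite /L (bigD1 (Ordinal np))//= lerDl sumr_ge0// => i _.
  exact: (HK i).1.
exists (P * (a ^+ p * L)) => [|f]; first by rewrite !mulr_ge0 ?exprn_ge0// ltW.
set S := schwartz_sum p.+1 f; have S0 : 0 <= S by exact: schwartz_sum_ge0.
pose C := a ^+ p * L * l2norm f + (a^-1 + a ^+ p * d) * S.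
have ap0 : 0 < a ^+ p by rewrite exprn_gt0.
apply: (@le_trans _ _ (P * C)); last first.
  have -> : P * C = P * (a ^+ p * L) * l2norm f + (P * a^-1 + P * (a ^+ p * d)) * S.
    by rewrite /C; ring.
  rewrite lerD2l ler_wpM2r//.
  have -> : P * (a ^+ p * d) = e / 2.
    by rewrite /d; field; rewrite !gt_eqF.
  have : P * a^-1 <= e / 2; last by lra.
  rewrite ler_pdivrMr// /a.
  have -> : e / 2 * (2 * P / e + 1) = P + e / 2 by field; rewrite gt_eqF.
  by rewrite lerDl divr_ge0// ltW.
apply: schwartz_sum_le_const => k n kp np; apply: schwartz_norm_le => x.
have l0 : 0 <= a ^+ p * L * l2norm f by rewrite (mulr_ge0 (mulr_ge0 (ltW ap0) L0) (l2norm_ge0 f)).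
have d1 : 0 <= a ^+ p * d * S by rewrite (mulr_ge0 (mulr_ge0 (ltW ap0) (ltW d0)) S0).
have a2 : 0 <= S / a by rewrite divr_ge0// ltW.
rewrite /C mulrDl [a^-1 * S]mulrC.
have [ax|xa] := leP a `|x|; first by have := schwartz_tail f a0 ax kp np; rewrite -/S; lra.
suff : `|x ^+ k * D n f x| <= a ^+ p * (L * l2norm f + d * S) by lra.
rewrite normrM ler_pM//.
  rewrite normrX (le_trans (lerXn2r _ _ _ (ltW xa))) ?nnegrE ?(ltW a0)//.
  by rewrite ler_weXn2l.
have := schwartz_norm_ub 0 n f x; rewrite expr0 mul1r => /le_trans; apply.
rewrite (le_trans ((HK n).2 f))// lerD// ?ler_wpM2r ?l2norm_ge0 ?KL//.
by rewrite ler_pM2l// schwartz_norm_le_sum.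
Qed.

End SchwartzL2.

(** * The strong topology of tempered distributions *)

Section Tempered.
Context {R : realType}.
Implicit Types (f g h : schwartz R) (x y : tempered R) (k n p q : nat).

Lemma nbhs_schwartz_ball p (e : R) f : 0 < e ->
  nbhs f [set g | schwartz_sum p (g - f) < e].
Proof.
move=> e0; rewrite nbhsE; exists [set g | schwartz_sum p (g - f) < e] => //.
split; last by rewrite /= subrr schwartz_sum0.
move=> g /= gf; pose P : R := (p.+1 * p.+1)%:R; have P0 : 0 < P by rewrite ltr0n.
exists p, ((e - schwartz_sum p (g - f)) / (2 * P)); split.
  by rewrite divr_gt0 ?mulr_gt0// subr_gt0.
move=> h hg /=.
have : schwartz_sum p (h - g) <= P * ((e - schwartz_sum p (g - f)) / (2 * P)).
  by apply: schwartz_sum_le_const => k n kp np; exact/ltW/hg.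
have -> : P * ((e - schwartz_sum p (g - f)) / (2 * P)) = (e - schwartz_sum p (g - f)) / 2.
  by field; rewrite gt_eqF.
have -> : h - f = (h - g) + (g - f) by rewrite addrA subrK.
have := schwartz_sumD p (h - g) (g - f); lra.
Qed.

Lemma temperedD x f g : x (f + g) = x f + x g.
Proof. by have := tempered_linear x 1 f g; rewrite scale1r /= mul1r. Qed.

Lemma tempered0 x : x 0 = 0.
Proof. by have := temperedD x 0 0; rewrite addr0; lra. Qed.

Lemma temperedZ x a f : x (a *: f) = a * x f.
Proof. by have := tempered_linear x a f 0; rewrite tempered0 !addr0. Qed.

Lemma temperedN x f : x (- f) = - x f.
Proof. by rewrite -scaleN1r temperedZ mulN1r. Qed.

Lemma temperedB x f g : x (f - g) = x f - x g.
Proof. by rewrite temperedD temperedN. Qed.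

(** Continuity at 0 bounds x on some seminorm ball, and homogeneity does the rest: a violating f,
    rescaled so that x takes the absolute value 1, would lie in that ball. *)
Lemma tempered_bounded x : exists q, exists2 C : R, 0 <= C &
  forall f, `|x f| <= C * schwartz_sum q f.
Proof.
have : nbhs (0 : schwartz R) [set f | `|x f| < 1].
  have := @tempered_continuous _ x 0; rewrite /continuous_at tempered0.
  move=> /cvgr0Pnorm_lt /(_ 1 ltr01) H.
  exact: H.
rewrite nbhsE => -[B [oB B0] BV]; have [q [e [e0 qB]]] := oB _ B0.
exists q, e^-1 => [|f]; first by rewrite invr_ge0 ltW.
rewrite leNgt; apply/negP => xf.
have x0 : 0 < `|x f|.
  by rewrite (le_lt_trans _ xf)// mulr_ge0 ?schwartz_sum_ge0// invr_ge0 ltW.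
have : `|x (`|x f|^-1 *: f)| < 1.
  apply: BV; apply: qB => k n kq nq; rewrite subr0.
  have := schwartz_norm_linear `|x f|^-1 k n f 0.
  rewrite addr0 schwartz_norm0 addr0 normfV normr_id// => /le_lt_trans; apply.
  rewrite mulrC ltr_pdivrMr// -ltr_pdivrMl// (le_lt_trans _ xf)// ler_pM2l ?invr_gt0//.
  exact: schwartz_norm_le_sum.
by rewrite temperedZ normrM normfV normr_id mulVf ?gt_eqF// ltxx.
Qed.

Lemma bounded_scalar_continuous (u : schwartz R -> R) q (C : R) : scalar u -> 0 <= C ->
  (forall f, `|u f| <= C * schwartz_sum q f) -> continuous u.
Proof.
move=> lu C0 uC f; apply/(@cvgrPdist_lt _ _ _ _ (nbhs_filter f)) => e e0; near=> g.
have -> : u f - u g = - u (g - f).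
  by have := lu (-1) f g; rewrite scaleN1r (addrC (- f)) => ->; rewrite /=; ring.
rewrite normrN (le_lt_trans (uC _))// (@le_lt_trans _ _ ((C + 1) * schwartz_sum q (g - f)))//.
  by rewrite ler_wpM2r ?schwartz_sum_ge0// lerDl.
rewrite -ltr_pdivlMl ?ltr_wpDl//; near: g; apply: nbhs_schwartz_ball.
by rewrite mulrC divr_gt0// ltr_wpDl.
Unshelve. all: by end_near. Qed.

Lemma tempered_of_bounded (u : schwartz R -> R) q (C : R) : scalar u -> 0 <= C ->
  (forall f, `|u f| <= C * schwartz_sum q f) ->
  exists x : tempered R, x = u :> (schwartz R -> R).
Proof.
move=> lu C0 uC; have cu := bounded_scalar_continuous lu C0 uC.
by exists (Tempered lu cu).
Qed.

Lemma temperedDP x y : exists z : tempered R, forall f, z f = x f + y f.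
Proof.
have [p [C C0 xC]] := tempered_bounded x; have [q [D D0 yD]] := tempered_bounded y.
have [||f|z zE] := @tempered_of_bounded (fun f => x f + y f) (maxn p q) (C + D).
- by move=> a f g; rewrite !temperedD !temperedZ /=; ring.
- exact: addr_ge0.
- rewrite (le_trans (ler_normD _ _))// mulrDl lerD//.
    by rewrite (le_trans (xC _))// ler_wpM2l// schwartz_sum_mono// leq_maxl.
  by rewrite (le_trans (yD _))// ler_wpM2l// schwartz_sum_mono// leq_maxr.
by exists z => f; rewrite zE.
Qed.

Definition tadd x y : tempered R := projT1 (cid (temperedDP x y)).

Lemma taddE x y f : tadd x y f = x f + y f.
Proof. by rewrite /tadd; case: cid. Qed.

Lemma temperedNP x : exists z : tempered R, forall f, z f = - x f.
Proof.
have [p [C C0 xC]] := tempered_bounded x.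
have [||f|z zE] := @tempered_of_bounded (fun f => - x f) p C => //.
- by move=> a f g; rewrite !temperedD !temperedZ /=; ring.
- by rewrite normrN.
by exists z => f; rewrite zE.
Qed.

Definition topp x : tempered R := projT1 (cid (temperedNP x)).

Lemma toppE x f : topp x f = - x f.
Proof. by rewrite /topp; case: cid. Qed.

Lemma vn_bounded_sum q (B : set (schwartz R)) : vn_bounded B ->
  exists2 M : R, 0 < M & forall f, B f -> schwartz_sum q f <= M.
Proof.
move=> /(_ _ (nbhs_schwartz_ball q 0 ltr01))[r [r0 rB]].
exists r => // f Bf; have := rB r; rewrite (ger0_norm (ltW r0)) => /(_ (lexx _) f Bf)[g].
rewrite /= subr0 => g1 <-; rewrite schwartz_sumZ (ger0_norm (ltW r0)).
by rewrite ler_piMr// ltW.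
Qed.

(** Only the difference y - x is required to have a finite dual norm of index q; x and y themselves
    may have larger order. *)
Definition dual_ball q (r : R) x : set (tempered R) :=
  [set y | forall f, `|y f - x f| <= r * schwartz_sum q f].

(** A von Neumann bounded set is bounded for [schwartz_sum q], so smallness in the dual norm is
    uniform smallness on it. The index q is arbitrary and given in advance. *)
Lemma open_dual_ball (U : set (tempered R)) x q : open U -> U x ->
  exists2 r, 0 < r & dual_ball q r x `<=` U.
Proof.
move=> [W oW WU] Ux.
pose ball r : set (schwartz R -> R) := [set h | forall f, `|h f - x f| <= r * schwartz_sum q f].
(* The filter of dual balls converges to x uniformly on bounded sets, hence contains the open set
   [W]. *)
pose G := filter_from [set r : R | 0 < r] ball.
have FG : Filter G.
  apply: filter_from_filter; first by exists 1 => /=.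
  move=> r s /= r0 s0; exists (Num.min r s); first by rewrite /= lt_min r0.
  move=> h hrs; split=> f; rewrite (le_trans (hrs f))// ler_wpM2r ?schwartz_sum_ge0//.
    by rewrite ge_min lexx.
  by rewrite ge_min lexx orbT.
have : G W.
  have /fam_cvgP : forall A, vn_bounded A -> {uniform A, G --> (x : schwartz R -> R)}.
    move=> A bA; have [M M0 AM] := vn_bounded_sum q bA.
    move=> Q /uniform_nbhs[E [entE EQ]].
    have [e e0 eE] : exists2 e : R, 0 < e & forall a b : R, `|a - b| < e -> E (a, b).
      by move: entE; rewrite -entourage_ballE => -[e e0 eE]; exists e => // a b ab; exact: eE.
    exists (e / (2 * M)); first by rewrite /= divr_gt0 ?mulr_gt0.
    move=> h hb; apply: EQ => f Af; apply: eE; rewrite distrC (le_lt_trans (hb f))//.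
    apply: (@le_lt_trans _ _ (e / (2 * M) * M)).
      by rewrite ler_pM2l ?AM// divr_gt0 ?mulr_gt0.
    have -> : e / (2 * M) * M = e / 2 by field; rewrite gt_eqF.
    lra.
  apply; apply: open_nbhs_nbhs; split => //.
  by move: Ux; rewrite -WU.
by move=> [r r0 rW]; exists r => // y yr; rewrite -WU; exact: rW.
Qed.

End Tempered.

(** * Separability of the Schwartz space and of the dual balls *)

Section Separability.
Context {R : realType}.
Implicit Types (f g h : schwartz R) (x y d : tempered R) (k n p q : nat).

(** Each f lies in a ball of integer radius for the norm of index p + 1; the countable family
    collects the finite nets of these balls for all p, radii and precisions. *)
Lemma schwartz_separable : exists (I : countType) (E : I -> schwartz R),
  forall p f (e : R), 0 < e -> exists i, schwartz_sum p (f - E i) <= e.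
Proof.
have /choice[F HF] : forall z : nat * nat * nat, exists F : seq (schwartz R),
    forall f, schwartz_sum z.1.1.+1 f <= z.1.2%:R ->
    exists g, [/\ g \in F, schwartz_sum z.1.1.+1 g <= z.1.2%:R &
      schwartz_sum z.1.1 (f - g) <= z.2.+1%:R^-1].
  by move=> z; apply: schwartz_totally_bounded; rewrite invr_gt0.
exists (nat * nat * nat * nat)%type, (fun z => nth 0 (F z.1) z.2) => p f e e0.
pose M := (Num.truncn (schwartz_sum p.+1 f)).+1.
pose j := Num.truncn e^-1.
have [|g [gF _ fg]] := HF (p, M, j) f; first exact/ltW/truncnS_gt.
exists (p, M, j, index g (F (p, M, j))); rewrite /= nth_index// (le_trans fg)//=.
by rewrite -[leRHS]invrK lef_pV2 ?posrE ?invr_gt0// ltW// truncnS_gt.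
Qed.

Lemma measurable_tempered_eval f :
  measurable_fun setT (fun x : tempered_measurable R => x f).
Proof.
move=> _ A mA; rewrite setTI; apply: sub_sigma_algebra.
exists 1%N, (fun=> f), [set t | A (tnth t ord0)]; split.
  by rewrite -[X in measurable X]setTI; exact: measurable_tnth.
by apply/seteqP; split => x /=; rewrite tnth_mktuple.
Qed.

(** The inequalities defining the ball may be tested on a countable dense family. The order of y is
    not bounded over the ball a priori, hence the need for density in every norm. *)
Lemma measurable_dual_ball q (r : R) d : 0 <= r ->
  measurable (dual_ball q r d : set (tempered_measurable R)).
Proof.
move=> r0; have [J [E HE]] := schwartz_separable.
pose B i : set (tempered_measurable R) := [set y | `|y (E i) - d (E i)| <= r * schwartz_sum q (E i)].
have -> : dual_ball q r d = ~` (\bigcup_i (~` B i)).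
  rewrite setC_bigcup; under eq_bigcapr do rewrite setCK.
  apply/seteqP; split=> y yB; first by move=> i _; exact: yB.
  move=> f; apply/ler_addgt0Pr => e e0.
  have [p [C C0 yC]] := tempered_bounded y; have [p' [C' C'0 dC]] := tempered_bounded d.
  pose P := maxn q (maxn p p').
  (* Replacing f by [E i] costs C for y, C' for d and r for the right-hand side; the summand 1 keeps
     the denominator positive. *)
  have h0 : 0 < e / (C + C' + r + 1) by rewrite divr_gt0// ltr_wpDl// !addr_ge0.
  have [i fi] := HE P f _ h0; have := yB i I; rewrite /B /=.
  set u := f - E i in fi; have -> : E i = f - u by rewrite /u opprB addrC subrK.
  clearbody u.
  have mono a : (a <= P)%N -> schwartz_sum a u <= e / (C + C' + r + 1).
    by move=> aP; rewrite (le_trans (schwartz_sum_mono _ aP)).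
  have yu : `|y u| <= C * (e / (C + C' + r + 1)).
    by rewrite (le_trans (yC u))// ler_wpM2l// mono// !leq_max leqnn orbT.
  have du : `|d u| <= C' * (e / (C + C' + r + 1)).
    by rewrite (le_trans (dC u))// ler_wpM2l// mono// !leq_max leqnn !orbT.
  have ru : r * schwartz_sum q (f - u) <= r * schwartz_sum q f + r * (e / (C + C' + r + 1)).
    rewrite -mulrDr ler_wpM2l// (le_trans (schwartz_sumB _ _ _))// lerD2l mono//.
    by rewrite !leq_max leqnn.
  move: ru yu du; set t := e / _ => ru yu du; rewrite !temperedB => ye.
  have te : (C + C' + r) * t <= e.
    rewrite /t mulrCA ler_piMr ?(ltW e0)// ler_pdivrMr ?mul1r ?lerDl//.
    by rewrite ltr_wpDl// !addr_ge0.
  have := ler_normD (y f - y u - (d f - d u)) (y u - d u).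
  have -> : y f - y u - (d f - d u) + (y u - d u) = y f - d f by ring.
  have := ler_normB (y u) (d u); lra.
apply: (@measurableC _ (tempered_measurable R)); apply: countable_bigcupT_measurable => // i.
apply: (@measurableC _ (tempered_measurable R)); rewrite -[X in measurable X]setTI.
apply: measurable_fun_le => //.
apply: measurableT_comp => //; apply: measurable_funB => //.
exact: measurable_tempered_eval.
Qed.

(** The Cameron-Martin directions: by Riesz, the functionals given by L^2 functions. *)
Definition l2bounded x := exists2 c : R, 0 <= c &
  forall f, x f ^+ 2 <= c * schwartz_inner f f.

(** If x is bounded by the norm of index p, Ehrling's inequality bounds it by a multiple of the L^2
    norm plus e times the norm of index p + 1, and [sublinear_split] separates the two. That index
    does not depend on e, so the approximation takes place in one dual norm. *)
Lemma l2bounded_dense x : exists p, forall e : R, 0 < e ->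
  exists2 g, l2bounded g & dual_ball p e g x.
Proof.
have [p [C C0 xC]] := tempered_bounded x; exists p.+1 => e e0.
have C1 : 0 < C + 1 by rewrite ltr_wpDl.
have [K K0 HK] := schwartz_ehrling p (divr_gt0 e0 C1).
have sq : sublinear (fun f => e * schwartz_sum p.+1 f).
  have [D Z] := schwartz_sublinear (R := R) p.+1; split=> [u v|t u t0].
    by rewrite -mulrDr ler_pM2l.
  by rewrite Z// mulrCA.
have [|g [lg gK xg]] := sublinear_split (l2norm_sublinear (mulr_ge0 C0 K0)) sq
    (tempered_linear x).
  move=> f; rewrite (le_trans (ler_norm _))// (le_trans (xC f))//.
  rewrite (le_trans (ler_wpM2l C0 (HK f)))// mulrDr mulrA lerD2l mulrA.
  rewrite ler_wpM2r ?schwartz_sum_ge0// mulrCA ler_piMr ?(ltW e0)//.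
  by rewrite ler_pdivrMr// mul1r lerDl.
have gN f : g (- f) = - g f.
  have g0 : g 0 = 0.
    by have := lg 1 0 0; rewrite scale1r addr0 /= mul1r; lra.
  by have := lg (-1) f 0; rewrite scaleN1r !addr0 /= mulN1r g0 addr0.
have l2N f : l2norm (- f) = l2norm f.
  have [_ Z] := l2norm_sublinear (R := R) ler01.
  by rewrite /l2norm -scaleN1r schwartz_innerZ schwartz_innerC schwartz_innerZ !mulN1r opprK.
have gC f : `|g f| <= C * K * l2norm f.
  by rewrite ler_norml gK andbT lerNl -gN -l2N gK.
have [D D0 HD] := l2norm_le_sum (R := R).
have [||y yg] := @tempered_of_bounded R g 1 (C * K * D) lg.
- by rewrite !mulr_ge0.
- by move=> f; rewrite (le_trans (gC f))// -[leRHS]mulrA ler_wpM2l// mulr_ge0.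
exists y.
  exists ((C * K) ^+ 2) => [|f]; first exact: sqr_ge0.
  rewrite yg -sqr_l2norm -exprMn -real_normK ?num_real// ler_pXn2r ?nnegrE//.
  by rewrite !mulr_ge0// l2norm_ge0.
move=> f; rewrite yg ler_norml xg andbT lerNl.
have := xg (- f); rewrite gN temperedN -[- f]scaleN1r schwartz_sumZ normrN1 mul1r; lra.
Qed.

Lemma l2bounded0 : l2bounded (point : tempered R).
Proof. by exists 0 => // f; rewrite mul0r expr0n. Qed.

Lemma dual_ball_unit q (e : R) x y :
  (forall f, schwartz_sum q f <= 1 -> `|y f - x f| <= e) -> dual_ball q e x y.
Proof.
move=> H f; have := schwartz_sum_ge0 q f; rewrite le_eqVlt => /predU1P[s0|s0].
  (* A vector of zero seminorm stays in the unit ball under any scaling; this one gives the value e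
     + 1. *)
  rewrite -s0 mulr0 leNgt; apply/negP => u0.
  have := H ((e + 1) / `|y f - x f| *: f).
  rewrite schwartz_sumZ -s0 mulr0 => /(_ ler01).
  rewrite !temperedZ -mulrBr normrM normrM normfV normr_id.
  rewrite -mulrA mulVf ?gt_eqF// mulr1 => /(le_trans (ler_norm _)); lra.
have := H ((schwartz_sum q f)^-1 *: f).
rewrite schwartz_sumZ normfV (ger0_norm (ltW s0)) mulVf ?gt_eqF// => /(_ (lexx _)).
rewrite !temperedZ -mulrBr normrM normfV (ger0_norm (ltW s0)).
by rewrite mulrC ler_pdivrMr.
Qed.

(** A functional of bounded dual norm is determined, up to a small error in the next dual norm, by
    its rounded values on a finite net of the unit ball. One L^2-bounded functional is chosen for
    each bound, net and table of integers; an unattained table yields the default [point], the zero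
    functional. *)
Lemma l2bounded_separable : exists (I : countType) (D : I -> tempered R),
  (forall i, l2bounded (D i)) /\
  forall x, exists q, forall e : R, 0 < e -> exists i, dual_ball q e (D i) x.
Proof.
have /choice[F HF] : forall z : nat * nat, exists F : seq (schwartz R),
    forall f, schwartz_sum z.1.+1 f <= 1 ->
    exists g, [/\ g \in F, schwartz_sum z.1.+1 g <= 1 &
      schwartz_sum z.1 (f - g) <= z.2.+1%:R^-1].
  by move=> z; apply: schwartz_totally_bounded; rewrite invr_gt0.
pose tab (p j : nat) x : seq int := [seq Num.floor (j.+1%:R * x f) | f <- F (p, j)].
pose good (z : nat * nat * nat * seq int) : set (tempered R) :=
  [set g | [/\ l2bounded g, (forall f, `|g f| <= z.1.1.2%:R * schwartz_sum z.1.1.1 f)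
             & tab z.1.1.1 z.1.2 g = z.2]].
exists (nat * nat * nat * seq int)%type, (fun z => xget point (good z)); split.
  by move=> z; case: xgetP => [d -> []//|_]; exact: l2bounded0.
move=> x; have [p1 Hx] := l2bounded_dense x.
have [p2 [C C0 xC]] := tempered_bounded x.
pose p := maxn p1 p2; exists p.+1 => e e0.
(* The bound 1 lets g inherit the constant C + 1 from x; e / 2 is its share of the error. *)
have e2 : 0 < Num.min 1 (e / 2) by rewrite lt_min ltr01 divr_gt0.
have [g gl2 xg] := Hx _ e2.
pose M := (Num.truncn (C + 1)).+1.
have CM : C + 1 <= M%:R by exact/ltW/truncnS_gt.
have gM f : `|g f| <= M%:R * schwartz_sum p f.
  have := ler_normB (x f) (x f - g f); rewrite subKr.
  have h1 : `|x f| <= C * schwartz_sum p f.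
    by rewrite (le_trans (xC f))// ler_wpM2l// schwartz_sum_mono// leq_maxr.
  have h2 : `|x f - g f| <= schwartz_sum p f.
    rewrite (le_trans (xg f))// -[leRHS]mul1r ler_pM ?schwartz_sum_ge0 ?(ltW e2)//.
      by rewrite ge_min lexx.
    by rewrite schwartz_sum_mono// leq_maxl.
  have : (C + 1) * schwartz_sum p f <= M%:R * schwartz_sum p f.
    by rewrite ler_wpM2r// schwartz_sum_ge0.
  lra.
(* Moving g and d from f to the net point costs M / (j + 1) each, and equality of the tables 1 / (j
   + 1). *)
pose c : R := 2 * M%:R + 1; have c0 : 0 < c by rewrite ltr_wpDl.
pose j := Num.truncn (2 * c / e).
have jc : c * j.+1%:R^-1 <= e / 2.
  have := truncnS_gt (2 * c / e); rewrite -/j ltr_pdivrMr// => h.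
  by rewrite ler_pdivrMr ?ltr0n//; lra.
exists (p, M, j, tab p j g).
case: xgetP => [d _ [_ dM dg]|/(_ g)]; last by case; split.
move: dM dg; rewrite /= => dM dg.
apply: dual_ball_unit => f f1.
have xgf : `|x f - g f| <= e / 2.
  rewrite (le_trans (xg f))// -[leRHS]mulr1 ler_pM ?schwartz_sum_ge0 ?(ltW e2)//.
    by rewrite ge_min lexx orbT.
  by rewrite (le_trans _ f1)// schwartz_sum_mono// ltnW// ltnS leq_maxl.
have [a [aF _ fa]] := HF (p, j) f f1; rewrite /= in fa.
have ga : `|g a - d a| <= j.+1%:R^-1.
  have /eq_in_map/(_ a aF) := dg.
  have j0 : 0 < j.+1%:R :> R by rewrite ltr0n.
  move=> fl; have /andP[d1 d2] := floor_itv (j.+1%:R * d a).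
  have /andP[g1 g2] := floor_itv (j.+1%:R * g a).
  rewrite fl in d1 d2; rewrite intrD in d2 g2.
  rewrite -[leRHS]mul1r ler_pdivlMr// -[j.+1%:R in leLHS]gtr0_norm// -normrM ler_norml.
  by apply/andP; split; lra.
have small y : (forall f, `|y f| <= M%:R * schwartz_sum p f) -> `|y f - y a| <= M%:R * j.+1%:R^-1.
  by move=> yM; rewrite -temperedB (le_trans (yM _))// ler_wpM2l.
have := small g gM; have := small d dM.
have -> : x f - d f = (x f - g f) + ((g f - g a) + ((g a - d a) - (d f - d a))) by ring.
move=> h1 h2.
apply: (le_trans (ler_normD _ _)).
apply: (@le_trans _ _ (e / 2 + c * j.+1%:R^-1)); last by rewrite [leRHS]splitr lerD2l.
rewrite lerD// (le_trans (ler_normD _ _))// /c mulrDl mul1r.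
apply: (@le_trans _ _ (M%:R / j.+1%:R + (j.+1%:R^-1 + M%:R / j.+1%:R))).
  by rewrite lerD// (le_trans (ler_normB _ _))// lerD.
by rewrite le_eqVlt; apply/orP; left; apply/eqP; ring.
Qed.

End Separability.

(** * Strongly open sets: measurability and covering by translates *)

Section OpenSets.
Context {R : realType}.
Implicit Types (x y d : tempered R) (U : set (tempered R)).

Lemma tempered_open_measurable U : open U -> measurable (U : set (tempered_measurable R)).
Proof.
move=> oU; have [J [D [_ HD]]] := l2bounded_separable (R := R).
pose B (z : nat * J * nat) : set (tempered_measurable R) :=
  dual_ball z.1.1 z.2.+1%:R^-1 (D z.1.2).
(* For y in U, a ball of radius at most r / 2 about some [D i] and containing y lies in the ball of
   radius r about y. *)
have -> : U = \bigcup_z (if `[< B z `<=` U >] then B z else set0).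
  apply/seteqP; split => [y Uy|y [z _]]; last first.
    by case: asboolP => // BU; exact: BU.
  have [q Hq] := HD y; have [r r0 rU] := open_dual_ball q oU Uy.
  pose k := Num.truncn (2 / r).
  have kr : k.+1%:R^-1 <= r / 2.
    by rewrite -[leRHS]invf_div lef_pV2 ?posrE ?divr_gt0// ltW// truncnS_gt.
  have k0 : (0 : R) < k.+1%:R^-1 by rewrite invr_gt0.
  have [i yi] := Hq _ k0; exists (q, i, k) => //.
  case: asboolP => // -[] z zi; apply: rU => f.
  have -> : z f - y f = (z f - D i f) - (y f - D i f) by ring.
  rewrite (le_trans (ler_normB _ _))//.
  have -> : r * schwartz_sum q f = r / 2 * schwartz_sum q f + r / 2 * schwartz_sum q f.
    by rewrite -mulrDl -splitr.
  by rewrite lerD//; [apply: le_trans (zi f) _|apply: le_trans (yi f) _];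
    rewrite ler_wpM2r ?schwartz_sum_ge0.
apply: countable_bigcupT_measurable => // z.
case: asboolP => // _; apply: measurable_dual_ball.
by rewrite invr_ge0.
Qed.

(** With x in U, it is y - x that is approximated by some [D i]; then y - [D i] is close to x. *)
Lemma l2bounded_cover U : open U -> U !=set0 ->
  exists (J : countType) (D : J -> tempered R), (forall i, l2bounded (D i)) /\
    forall y, exists i, U (tadd y (topp (D i))).
Proof.
move=> oU [x Ux]; have [J [D [Dl2 HD]]] := l2bounded_separable (R := R).
exists J, D; split => // y; have [q Hq] := HD (tadd y (topp x)).
have [r r0 rU] := open_dual_ball q oU Ux; have [i yi] := Hq _ r0; exists i.
apply: rU => f; have := yi f; rewrite !taddE !toppE.
by congr (_ <= _); congr `|_|; ring.
Qed.

End OpenSets.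

(** * Positive definite kernels *)

Section Kernels.
Context {R : realType} {T : Type}.
Implicit Types (P Q : T -> T -> R) (s : seq (R * T)).

(** The list s is a finitely supported signed measure, with repeated points allowed. *)
Definition qform P s : R := \sum_(u <- s) \sum_(v <- s) u.1 * v.1 * P u.2 v.2.

Definition psd P := forall s, 0 <= qform P s.

Lemma qformD P Q s : qform (fun u v => P u v + Q u v) s = qform P s + qform Q s.
Proof.
rewrite /qform -big_split; apply: eq_bigr => u _ /=.
by rewrite -big_split; apply: eq_bigr => v _; rewrite mulrDr.
Qed.

Lemma qformZ c P s : qform (fun u v => c * P u v) s = c * qform P s.
Proof.
rewrite /qform mulr_sumr; apply: eq_bigr => u _ /=.
by rewrite mulr_sumr; apply: eq_bigr => v _; rewrite mulrCA.
Qed.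

Lemma qformB P Q s : qform (fun u v => P u v - Q u v) s = qform P s - qform Q s.
Proof.
rewrite -[in RHS]mulN1r -qformZ -qformD.
by apply: eq_bigr => u _; apply: eq_bigr => v _; rewrite mulN1r.
Qed.

Lemma qform_rank1 (g : T -> R) s :
  qform (fun u v => g u * g v) s = (\sum_(u <- s) u.1 * g u.2) ^+ 2.
Proof.
rewrite expr2 big_distrlr /=; apply: eq_bigr => u _; apply: eq_bigr => v _.
by rewrite mulrACA.
Qed.

Lemma qform_twist P (g : T -> R) s :
  qform (fun u v => g u * g v * P u v) s = qform P [seq (u.1 * g u.2, u.2) | u <- s].
Proof.
rewrite /qform big_map; apply: eq_bigr => u _; rewrite big_map.
by apply: eq_bigr => v _ /=; ring.
Qed.

Lemma psd_twist P (g : T -> R) : psd P -> psd (fun u v => g u * g v * P u v).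
Proof. by move=> P0 s; rewrite qform_twist. Qed.

Lemma cvg_sum_seq (I : Type) (r : seq I) (F : I -> nat -> R) (G : I -> R) :
  (forall i, F i n @[n --> \oo] --> G i) ->
  \sum_(i <- r) F i n @[n --> \oo] --> \sum_(i <- r) G i.
Proof. by move=> FG; apply: cvg_big => //; exact: add_continuous. Qed.

Lemma qform_cvg (Pn : nat -> T -> T -> R) P s :
  (forall u v, Pn n u v @[n --> \oo] --> P u v) ->
  qform (Pn n) s @[n --> \oo] --> qform P s.
Proof.
move=> PnP; apply: cvg_sum_seq => u; apply: cvg_sum_seq => v.
by apply: cvgMl_tmp; exact: PnP.
Qed.

Lemma cvg_ge0 (u : nat -> R) l : u n @[n --> \oo] --> l -> (forall n, 0 <= u n) -> 0 <= l.
Proof.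
move=> ul u0; have cu : cvgn u by exact: cvgP ul.
by have := @limr_ge nat \oo _ R 0 u cu (nearW _ u0); rewrite (cvg_lim (@norm_hausdorff _ _) ul); apply.
Qed.

Lemma series0 (u : nat -> R) : series u 0%N = 0.
Proof. by rewrite /series/= big_geq. Qed.

Lemma cvg_expR_series (x : R) : series (exp_coeff x) n @[n --> \oo] --> expR x.
Proof. exact: is_cvg_series_exp_coeff. Qed.

(** The exponential series has nonnegative coefficients, and positivity passes to limits of partial
    sums. *)
Lemma psd_expB P Q : (forall n, psd (fun u v => P u v ^+ n - Q u v ^+ n)) ->
  psd (fun u v => expR (P u v) - expR (Q u v)).
Proof.
move=> PQ s.
apply: (@cvg_ge0 (fun n => qform (fun u v =>
    series (exp_coeff (P u v)) n - series (exp_coeff (Q u v)) n) s)).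
  by apply: qform_cvg => u v; apply: cvgB; exact: cvg_expR_series.
elim=> [|n IH].
  rewrite /qform big1// => u _; rewrite big1// => v _.
  by rewrite !series0 subrr mulr0.
have -> : qform (fun u v => series (exp_coeff (P u v)) n.+1 - series (exp_coeff (Q u v)) n.+1) s
  = qform (fun u v => series (exp_coeff (P u v)) n - series (exp_coeff (Q u v)) n) s
    + n`!%:R^-1 * qform (fun u v => P u v ^+ n - Q u v ^+ n) s.
  rewrite -qformZ -qformD; apply: eq_bigr => u _; apply: eq_bigr => v _.
  congr (_ * _); rewrite !seriesSr /exp_coeff /=; ring.
by apply: addr_ge0 => //; apply: mulr_ge0; [rewrite invr_ge0|exact: PQ].
Qed.

(* With [y_n = \sum b h^n / sqrt (c^n n!)] the left-hand sum is the scalar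
   product of [y] with a vector of squared norm [cosh c]. *)
Lemma cos_sum_le (h : T -> R) (c : R) s : 0 < c ->
  (\sum_(u <- s) u.1 * cos (h u.2)) ^+ 2 <=
  expR c * qform (fun u v => expR (h u * h v / c)) s.
Proof.
move=> c0.
set l := \sum_(u <- s) _; set Q := qform _ s.
(* Cauchy-Schwarz as a nonnegative quadratic in t: in this form the inequality is additive along the
   series and can be proved by induction on the partial sums. *)
have H t : 0 <= Q - 2 * t * l + t ^+ 2 * expR c.
  pose e n : R := (~~ odd n)%:R * (-1) ^+ n./2.
  pose w n := \sum_(k < n) e k ^+ 2 * exp_coeff c k.
  pose Qn n := qform (fun u v => series (exp_coeff (h u * h v / c)) n) s.
  pose ln n := \sum_(u <- s) u.1 * series (cos_coeff (h u.2)) n.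
  apply: (@cvg_ge0 (fun n => Qn n - 2 * t * ln n + t ^+ 2 * series (exp_coeff c) n)).
    apply: cvgD; last by apply: cvgMl_tmp; exact: cvg_expR_series.
    apply: cvgB; first by apply: qform_cvg => u v; exact: cvg_expR_series.
    apply: cvgMl_tmp; apply: cvg_sum_seq => u; apply: cvgMl_tmp.
    by rewrite cos.unlock; exact: is_cvg_series_cos_coeff.
  elim=> [|n IH].
    rewrite series0 /Qn /ln /qform big1; last first.
      by move=> u _; rewrite big1// => v _; rewrite series0 mulr0.
    by rewrite big1 ?mulr0 ?subr0 ?addr0// => u _; rewrite series0 mulr0.
  pose Y := \sum_(u <- s) u.1 * h u.2 ^+ n.
  have QS : Qn n.+1 = Qn n + (c ^+ n * n`!%:R)^-1 * Y ^+ 2.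
    rewrite /Y -(qform_rank1 (fun x => h x ^+ n)) -qformZ -qformD; apply: eq_bigr => u _; apply: eq_bigr => v _.
    by congr (_ * _); rewrite seriesSr /exp_coeff /= invfM !exprMn exprVn; ring.
  have lS : ln n.+1 = ln n + e n / n`!%:R * Y.
    rewrite /ln /Y mulr_sumr -big_split; apply: eq_bigr => u _ /=.
    by rewrite seriesSr cos_coeffE /= mulrDr; congr (_ + _); rewrite /e; ring.
  rewrite QS lS seriesSr /exp_coeff /=.
  have e1 : e n ^+ 2 <= 1.
    by rewrite /e exprMn -exprM mulnC exprM sqrrN expr1n expr1n mulr1; case: odd => /=; rewrite ?expr0n ?expr1n.
  have cn : c ^+ n != 0 by rewrite gt_eqF// exprn_gt0.
  have nn : n`!%:R != 0 :> R by rewrite pnatr_eq0 -lt0n fact_gt0.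
  (* The n-th increment is a square plus a term that completes the even part cosh c to e^c. *)
  have : 0 <= (c ^+ n * n`!%:R)^-1 * ((Y - t * e n * c ^+ n) ^+ 2 +
      t ^+ 2 * (1 - e n ^+ 2) * c ^+ n ^+ 2).
    apply: mulr_ge0; first by rewrite invr_ge0; apply: mulr_ge0 => //; apply/exprn_ge0/ltW.
    by rewrite addr_ge0 ?sqr_ge0//; apply: mulr_ge0; rewrite ?sqr_ge0// mulr_ge0 ?sqr_ge0 ?subr_ge0.
  have -> : (c ^+ n * n`!%:R)^-1 * ((Y - t * e n * c ^+ n) ^+ 2 +
      t ^+ 2 * (1 - e n ^+ 2) * c ^+ n ^+ 2) =
      (c ^+ n * n`!%:R)^-1 * Y ^+ 2 - 2 * t * (e n / n`!%:R * Y) + t ^+ 2 * (c ^+ n / n`!%:R).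
    by field; rewrite cn nn.
  lra.
have E0 : 0 < expR c by exact: expR_gt0.
have := H (l / expR c).
have -> : Q - 2 * (l / expR c) * l + (l / expR c) ^+ 2 * expR c =
  (expR c * Q - l ^+ 2) / expR c by field; rewrite gt_eqF.
by rewrite pmulr_lge0 ?invr_gt0// subr_ge0.
Qed.

End Kernels.

(** * A Cameron-Martin inequality for Gaussian kernels *)

Section SchwartzKernels.
Context {R : realType}.
Implicit Types (f g : schwartz R) (s : seq (R * schwartz R)).
Local Notation inner := schwartz_inner.

Lemma inner_suml s g : inner (\sum_(u <- s) u.1 *: u.2) g = \sum_(u <- s) u.1 * inner u.2 g.
Proof.
elim: s => [|u s IH]; first by rewrite !big_nil schwartz_inner0.
by rewrite !big_cons schwartz_inner_linear IH.
Qed.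

Lemma qform_inner s :
  qform inner s = inner (\sum_(u <- s) u.1 *: u.2) (\sum_(u <- s) u.1 *: u.2).
Proof.
rewrite inner_suml; apply: eq_bigr => u _.
rewrite schwartz_innerC inner_suml mulr_sumr; apply: eq_bigr => v _.
by rewrite mulrA schwartz_innerC.
Qed.

Lemma tempered_sum (x : tempered R) s :
  x (\sum_(u <- s) u.1 *: u.2) = \sum_(u <- s) u.1 * x u.2.
Proof.
elim: s => [|u s IH]; first by rewrite !big_nil tempered0.
by rewrite !big_cons temperedD temperedZ IH.
Qed.

(* Schur product theorem, the inner product being an integral of rank one kernels. *)
Lemma psd_inner_mul P : psd P -> psd (fun f g => inner f g * P f g).
Proof.
move=> P0 s.
have iM a f g (b : R) : lebesgue_measure.-integrable setT
    (EFin \o (fun t : R => a * (f t * g t * b))).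
  apply: integrableZl_EFin; have := integrableZl_EFin b (schwartz_mul_integrable f g).
  by congr (_.-integrable _ _); apply/funext => t /=; rewrite mulrC.
have -> : qform (fun f g => inner f g * P f g) s =
    \int[lebesgue_measure]_t qform P [seq (u.1 * (u.2 : schwartz R) t, u.2) | u <- s].
  transitivity (\int[lebesgue_measure]_t (\sum_(u <- s) \sum_(v <- s)
      (u.1 * v.1) * (u.2 t * v.2 t * P u.2 v.2))).
    rewrite Rintegral_sum; last by move=> u; exact: integrable_sum_EFin.
    apply: eq_bigr => u _; rewrite Rintegral_sum//; apply: eq_bigr => v _.
    rewrite RintegralZl//; last by have := iM 1 u.2 v.2 (P u.2 v.2); under eq_fun do rewrite mul1r.
    by rewrite RintegralZr//; exact: schwartz_mul_integrable.
  apply: eq_Rintegral => t _; rewrite /qform big_map; apply: eq_bigr => u _.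
  by rewrite big_map; apply: eq_bigr => v _ /=; ring.
by apply: Rintegral_ge0 => t _; exact: P0.
Qed.

(** Write A^(n+1) - B^(n+1) = A (A^n - B^n) + B^n (A - B). The first term is handled by the Schur
    product, the second by twisting with h^n, and A - B is positive because k >= 1. *)
Lemma psd_inner_powB (h : tempered R) (c k : R) n : 0 < c -> 1 <= k ->
  (forall f, h f ^+ 2 <= c * inner f f) ->
  psd (fun f g => (k * inner f g) ^+ n - (h f * h g / c) ^+ n).
Proof.
move=> c0 k1 hc; elim: n => [|n IH] s.
  by rewrite qformB subrr.
have -> : qform (fun f g => (k * inner f g) ^+ n.+1 - (h f * h g / c) ^+ n.+1) s =
  k * qform (fun f g => inner f g * ((k * inner f g) ^+ n - (h f * h g / c) ^+ n)) s +
  c^-1 ^+ n * qform (fun f g => h f ^+ n * h g ^+ n * (k * inner f g - h f * h g / c)) s.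
  rewrite -!qformZ -qformD; apply: eq_bigr => u _; apply: eq_bigr => v _.
  by congr (_ * _); rewrite !exprS !exprMn; ring.
apply: addr_ge0; apply: mulr_ge0.
- exact: le_trans k1.
- exact: (psd_inner_mul IH).
- by apply: exprn_ge0; rewrite invr_ge0 ltW.
apply: (@psd_twist _ _ _ (fun f => h f ^+ n)) => {}s.
rewrite qformB qformZ.
have -> : qform (fun f g => h f * h g / c) s = c^-1 * h (\sum_(u <- s) u.1 *: u.2) ^+ 2.
  rewrite tempered_sum -qform_rank1 -qformZ; apply: eq_bigr => u _; apply: eq_bigr => v _.
  by rewrite (mulrC _ c^-1).
rewrite qform_inner subr_ge0; set X := \sum_(u <- s) _.
rewrite mulrC ler_pdivrMr// (le_trans (hc X))// mulrC ler_wpM2r ?(ltW c0)//.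
by rewrite ler_peMl// schwartz_inner_ge0.
Qed.

(** Expanding the square factors the Gaussian kernel as G f G g e^(k inner f g); the factors G go
    into the weights. What remains is to compare e^(k inner f g) with e^(h f h g / c). The constant
    is free of k, so the inequality can be averaged over k. *)
Lemma gauss_kernel_cos_le (h : tempered R) (c k : R) s : 0 < c -> 1 <= k ->
  (forall f, h f ^+ 2 <= c * inner f f) ->
  (\sum_(u <- s) u.1 * (cos (h u.2) * expR (- k * (2^-1 * inner u.2 u.2)))) ^+ 2 <=
  expR c * qform (fun f g => expR (- k * (2^-1 * inner (f - g) (f - g)))) s.
Proof.
move=> c0 k1 hc; pose G f : R := expR (- k * (2^-1 * inner f f)).
pose s' := [seq (u.1 * G u.2, u.2) | u <- s].
have -> : \sum_(u <- s) u.1 * (cos (h u.2) * expR (- k * (2^-1 * inner u.2 u.2))) =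
    \sum_(u <- s') u.1 * cos (h u.2).
  by rewrite big_map; apply: eq_bigr => u _ /=; rewrite /G; ring.
rewrite (le_trans (cos_sum_le (fun f => h f) s' c0))// ler_pM2l ?expR_gt0//.
have -> : qform (fun f g => expR (- k * (2^-1 * inner (f - g) (f - g)))) s =
    qform (fun f g => expR (k * inner f g)) s'.
  rewrite -qform_twist; apply: eq_bigr => u _; apply: eq_bigr => v _.
  congr (_ * _); rewrite /G -!expRD; congr expR.
  have := schwartz_inner_sumB (-1) v.2 u.2; rewrite scaleN1r addrC => ->.
  by rewrite schwartz_innerC; field.
rewrite -subr_ge0 -qformB; apply: psd_expB => n.
exact: psd_inner_powB.
Qed.

End SchwartzKernels.

(** * The incomplete Gamma function as a mixture of exponentials *)

Section GammaMixture.
Context {R : realType}.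
Local Notation mu := (@lebesgue_measure R).

Lemma sqr_le_expR (z : R) : 0 <= z -> z ^+ 2 <= 4 * expR z.
Proof.
move=> z0; have -> : expR z = expR (z / 2) ^+ 2 by rewrite expr2 -expRD -splitr.
have h := expR_ge1Dx (z / 2).
have -> : 4 * expR (z / 2) ^+ 2 = (2 * expR (z / 2)) ^+ 2 by ring.
by rewrite ler_pXn2r// ?nnegrE ?mulr_ge0 ?expR_ge0//; lra.
Qed.

(* [s `^ (b - 1) * expR (- s) ds] under [s = expR v]: the singularity at [s = 0] is
   sent to [-oo]. *)
Definition gumbel (b v : R) : R := expR (b * v - expR v).

(** After multiplication by 1 + v^2 the bound is 1 + 4 / b^2 for v <= 0 and 20 = 5 times 4 for v >
    0; the constant is their sum. *)
Lemma gumbel_le (b : R) : 0 < b -> b <= 1 ->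
  forall v, gumbel b v <= (21 + 4 / b ^+ 2) * (oneDsqr v)^-1.
Proof.
move=> b0 b1 v; rewrite ler_pdivlMr ?(lt_le_trans _ (oneDsqr_ge1 v))// /oneDsqr /gumbel.
have b2 : 0 <= 4 / b ^+ 2 by rewrite divr_ge0// sqr_ge0.
rewrite expRD; have [v0|v0] := leP v 0.
  have e1 : expR (- expR v) <= 1.
    by rewrite -expR0 ler_expR oppr_le0 expR_ge0.
  have e2 : expR (b * v) <= 1 by rewrite -expR0 ler_expR pmulr_rle0.
  have e3 : expR (b * v) * v ^+ 2 <= 4 / b ^+ 2.
    have z0 : 0 <= - (b * v) by rewrite oppr_ge0 pmulr_rle0.
    have := sqr_le_expR z0; rewrite sqrrN exprMn expRN => h.
    rewrite ler_pdivlMr ?expR_gt0// in h; rewrite ler_pdivlMr ?exprn_gt0//.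
    by have -> : expR (b * v) * v ^+ 2 * b ^+ 2 = b ^+ 2 * v ^+ 2 * expR (b * v) by ring.
  apply: (@le_trans _ _ (expR (b * v) * (1 + v ^+ 2))).
    by rewrite ler_wpM2r ?addr_ge0 ?sqr_ge0// ler_piMr ?expR_ge0.
  by rewrite mulrDr mulr1; lra.
have y1 := expR_ge1Dx v; set y := expR v in y1 *.
have e1 : 1 + v ^+ 2 <= 5 * y by have := sqr_le_expR (ltW v0); rewrite -/y; lra.
have e2 : expR (b * v) <= y.
  by rewrite ler_expR ler_piMl// ltW.
have y0 : 0 < y by exact: expR_gt0.
have e3 : y ^+ 2 * expR (- y) <= 4.
  by rewrite expRN ler_pdivrMr ?expR_gt0// sqr_le_expR// ltW.
apply: (@le_trans _ _ (y * expR (- y) * (5 * y))).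
  by rewrite ler_pM ?mulr_ge0 ?expR_ge0 ?addr_ge0 ?sqr_ge0// ler_wpM2r ?expR_ge0.
have -> : y * expR (- y) * (5 * y) = 5 * (y ^+ 2 * expR (- y)) by ring.
by lra.
Qed.

Lemma continuous_gumbel (b : R) : continuous (gumbel b).
Proof.
move=> v; apply: continuous_comp; last exact: continuous_expR.
apply: cvgB; last exact: continuous_expR.
by apply: cvgMl_tmp; exact: cvg_id.
Qed.

Lemma integrable_gumbel (b : R) : 0 < b -> b <= 1 ->
  mu.-integrable setT (EFin \o gumbel b).
Proof.
move=> b0 b1; have := integrableZl_EFin (21 + 4 / b ^+ 2) (integrable_oneDsqrV (R := R)).
apply: le_integrable => //.
  by apply/measurable_EFinP; apply: continuous_measurable_fun; exact: continuous_gumbel.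
move=> v _ /=; rewrite lee_fin ger0_norm ?expR_ge0//.
by rewrite (le_trans (gumbel_le b0 b1 v))// ler_norm.
Qed.

Lemma ge0_integral_shift (G : R -> R) (a : R) : continuous G -> (forall v, 0 <= G v) ->
  (\int[mu]_v (G v)%:E = \int[mu]_v (G (v + a))%:E)%E.
Proof.
move=> cG G0; pose F v : R := v + a.
have dF v : is_derive v (1 : R) F 1.
  by rewrite /F -[X in is_derive _ _ _ X]addr0; apply: is_deriveD.
have F1 : F^`()%classic = cst 1.
  by apply/funext => v; rewrite derive1E; apply: derive_val.
rewrite (@increasing_ge0_integration_by_substitutionT _ F G)//.
- by apply: eq_integral => v _; rewrite F1/= mulr1.
- by move=> u v uv; rewrite ltrD2r.
- by rewrite F1; exact: cst_continuous.
- by rewrite F1; exact: is_cvg_cst.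
- by rewrite F1; exact: is_cvg_cst.
- by apply: cvg_addrr_Ny.
- by apply: cvg_addrr.
Qed.

(** Euler's integral for w^(-b) in logarithmic coordinates, where scaling by w is translation by ln
    w. *)
Lemma integral_gumbel_scale (b w : R) : 0 < w ->
  (\int[mu]_v (expR (b * v - w * expR v))%:E =
   (w `^ (- b))%:E * \int[mu]_v (gumbel b v)%:E)%E.
Proof.
move=> w0; rewrite (ge0_integral_shift (ln w) (@continuous_gumbel b)); last first.
  by move=> v; exact: expR_ge0.
rewrite -ge0_integralZl//; last 3 first.
- apply/measurable_EFinP; apply: continuous_measurable_fun => v.
  apply: continuous_comp; last exact: continuous_gumbel.
  by apply: cvgD; [exact: cvg_id|exact: cvg_cst].
- by move=> v _; rewrite lee_fin expR_ge0.
- by rewrite lee_fin powR_ge0.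
apply: eq_integral => v _; rewrite -EFinM; congr EFin.
rewrite /gumbel /powR gt_eqF// -expRD; congr expR.
by rewrite expRD lnK//; ring.
Qed.

Lemma integral_expR_tail (k y : R) : 0 < k ->
  (\int[mu]_(w in `[y, +oo[) (expR (- (k * w)))%:E = (expR (- (k * y)) / k)%:E)%E.
Proof.
move=> k0; pose F w : R := - (expR (- (k * w)) / k).
have dF w : is_derive w (1 : R) F (expR (- (k * w))).
  rewrite /F; apply: is_derive_eq.
  by rewrite /GRing.scale /=; field; rewrite gt_eqF.
rewrite (@ge0_continuous_FTC2y _ _ F y 0).
- by rewrite sub0e /F EFinN oppeK.
- by move=> w _; exact: expR_ge0.
- apply: continuous_subspaceT => w; apply: continuous_comp; last exact: continuous_expR.
  by apply: cvgN; apply: cvgMl_tmp; exact: cvg_id.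
- rewrite /F -[X in _ --> X]oppr0; apply: cvgN.
  rewrite -[X in _ --> X](mul0r k^-1); apply: cvgMr_tmp.
  apply: (@cvg_comp _ _ _ (fun w => k * w) (fun w => expR (- w)) _ +oo%R); last exact: cvgr_expR.
  by apply: gt0_cvgMry => //; exact: cvg_id.
- by move=> w _.
- by apply: cvg_at_right_filter; apply: differentiable_continuous; apply/derivable1_diffP.
- by move=> w _; rewrite derive1E; apply: derive_val.
Qed.

End GammaMixture.

(** * The kernel inequality for the incomplete Gamma function *)

Section GammaKernel.
Context {R : realType}.
Local Notation mu := (@lebesgue_measure R).

(** The quotient is the integral of e^(-(1 + e^v) w) over w >= y. Since y enters through an
    exponential only, adding half a squared norm to y multiplies the weight by a Gaussian factor of
    variance 1 + e^v. *)
Definition gamma_weight (b y v : R) : R :=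
  expR (b * v) * (expR (- ((1 + expR v) * y)) / (1 + expR v)).

(* Fubini, after writing [w `^ (- b)] as the Laplace transform of a measure,
   parametrized by [v |-> expR v]. *)
Lemma integral_gamma_mixture (b y : R) : 0 < b -> 0 < y ->
  ((\int[mu]_v (gumbel b v)%:E) * \int[mu]_(w in `[y, +oo[) (expR (- w) * w `^ (- b))%:E =
   \int[mu]_v (gamma_weight b y v)%:E)%E.
Proof.
move=> b0 y0; pose I : set R := `[y, +oo[%classic.
have mI : measurable I by exact: measurable_itv.
pose f (z : R * R) : \bar R := (\1_I z.1 * expR (- z.1 + (b * z.2 - z.1 * expR z.2)))%:E.
have mf : measurable_fun setT f.
  apply/measurable_EFinP; apply: measurable_funM.
    exact: (measurableT_comp (measurable_indic mI) measurable_fst).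
  apply: (measurableT_comp (@measurable_expR R)); apply: measurable_funD.
    by apply: measurable_funN; exact: measurable_fst.
  apply: measurable_funB; first exact: measurable_funM.
  by apply: measurable_funM => //; exact: (measurableT_comp (@measurable_expR R)).
have f0 z : (0 <= f z)%E by rewrite lee_fin mulr_ge0// expR_ge0.
have g0 : (0 <= \int[mu]_v (gumbel b v)%:E)%E by apply: integral_ge0 => v _; rewrite lee_fin expR_ge0.
have mew : measurable_fun I (fun w : R => (expR (- w) * w `^ (- b))%:E).
  apply/measurable_EFinP; apply: measurable_funTS; apply: measurable_funM.
    exact: (measurableT_comp (@measurable_expR R)).
  exact: measurable_powR.
transitivity (\int[mu]_w \int[mu]_v f (w, v))%E.
  rewrite -ge0_integralZl//; last by move=> w _; rewrite lee_fin mulr_ge0 ?expR_ge0 ?powR_ge0.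
  rewrite integral_mkcond; apply: eq_integral => w _; rewrite patchE; case: ifPn => wI.
    have w0 : 0 < w by move: wI; rewrite inE /I /= in_itv/= andbT; exact: lt_le_trans.
    rewrite EFinM muleCA muleC (muleC _ (w `^ _)%:E) -integral_gumbel_scale// muleC -ge0_integralZl//.
    - apply: eq_integral => v _; rewrite -EFinM /f/= indicE wI mul1r; congr EFin.
      by rewrite -expRD.
    - apply/measurable_EFinP; apply: (measurableT_comp (@measurable_expR R)).
      apply: measurable_funB; first exact: measurable_funM.
      by apply: measurable_funM.
  rewrite [LHS](_ : _ = 0%E)//; apply/esym; apply: integral0_eq => v _.
  by rewrite /f /= indicE (negbTE wI) mul0r.
transitivity (\int[mu]_v \int[mu]_w f (w, v))%E; first exact: fubini_tonelli.
apply: eq_integral => v _.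
transitivity ((expR (b * v))%:E * \int[mu]_(w in I) (expR (- ((1 + expR v) * w)))%:E)%E; last first.
  by rewrite integral_expR_tail ?EFinM// addr_gt0 ?expR_gt0.
rewrite -ge0_integralZl//; last first.
  apply/measurable_EFinP; apply: measurable_funTS.
  apply: (measurableT_comp (@measurable_expR R)).
  by apply: measurable_funN; exact: measurable_funM.
rewrite [RHS]integral_mkcond; apply: eq_integral => w _; rewrite patchE /f/= indicE.
case: ifPn => wI; last by rewrite mul0r.
rewrite mul1r -EFinM -expRD; congr (expR _)%:E; ring.
Qed.

Lemma gamma_weight_ge0 (b y v : R) : 0 <= gamma_weight b y v.
Proof. by rewrite mulr_ge0 ?expR_ge0// divr_ge0 ?expR_ge0// addr_ge0 ?expR_ge0. Qed.

Lemma gamma_weightD (b y x v : R) :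
  gamma_weight b (y + x) v = gamma_weight b y v * expR (- (1 + expR v) * x).
Proof. by rewrite /gamma_weight mulrDr opprD expRD mulNr; ring. Qed.

Lemma measurable_gamma_weight (b y : R) : measurable_fun setT (gamma_weight b y).
Proof.
have h : measurable_fun setT (fun v : R => 1 + expR v).
  by apply: measurable_funD => //; exact: measurable_expR.
apply: measurable_funM.
  by apply: (measurableT_comp (@measurable_expR R)); exact: measurable_funM.
apply: measurable_funM.
  apply: (measurableT_comp (@measurable_expR R)); apply: measurable_funN.
  exact: measurable_funM.
apply: continuous_measurable_fun => v; apply: cvgV.
  by rewrite gt_eqF// addr_gt0// expR_gt0.
by apply: cvgD; [exact: cvg_cst|exact: continuous_expR].
Qed.

Lemma integrable_gamma_weight (b y : R) : 0 < b -> b <= 1 -> 0 < y ->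
  mu.-integrable setT (EFin \o gamma_weight b y).
Proof.
move=> b0 b1 y0; apply/integrableP; split.
  by apply/measurable_EFinP; exact: measurable_gamma_weight.
apply: (@le_lt_trans _ _ (\int[mu]_v (expR (b * v - y * expR v))%:E)%E).
  apply: ge0_le_integral => //.
  - by apply: measurableT_comp => //; apply/measurable_EFinP; exact: measurable_gamma_weight.
  - apply/measurable_EFinP; apply: (measurableT_comp (@measurable_expR R)).
    apply: measurable_funB; first exact: measurable_funM.
    by apply: measurable_funM.
  - move=> v _ /=; rewrite lee_fin ger0_norm ?gamma_weight_ge0//.
    rewrite expRD ler_wpM2l ?expR_ge0// ler_pdivrMr ?addr_gt0 ?expR_gt0//.
    rewrite mulrDl mul1r opprD expRD mulrC (mulrC y) ler_wpM2l ?expR_ge0//.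
    apply: (@le_trans _ _ 1); last by rewrite lerDl expR_ge0.
    by rewrite -expR0 ler_expR oppr_le0 ltW.
rewrite integral_gumbel_scale//.
have /integrable_fin_num := integrable_gumbel b0 b1; move=> /(_ measurableT) Cfin.
by rewrite -[X in (_ * X)%E]fineK// -EFinM ltry.
Qed.

Lemma gumbel_integral_gt0 (b : R) : 0 < b -> b <= 1 -> 0 < \int[mu]_v gumbel b v.
Proof.
move=> b0 b1; have ci := integrable_gumbel b0 b1.
pose I : set R := `[0, 1]%classic.
have mI : measurable I by exact: measurable_itv.
have muI : mu I = 1%:E by rewrite /I lebesgue_measure_itv/= lte_fin ltr01 -EFinD subr0.
apply: (@lt_le_trans _ _ (\int[mu]_(v in I) expR (- expR 1))).
  by rewrite Rintegral_cst//= muI mulr1; exact: expR_gt0.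
rewrite Rintegral_mkcond; apply: le_Rintegral => //.
- rewrite -restrict_EFin; apply/integrable_restrict => //=; rewrite setTI.
  apply: measurable_bounded_integrable => //.
    by have := ltry (1 : R); rewrite -muI.
  exact: bounded_cst.
- move=> v _; rewrite patchE; case: ifPn => [|_]; last exact: expR_ge0.
  rewrite inE /I /= in_itv/= => /andP[v0 v1]; rewrite ler_expR.
  have : expR v <= expR 1 by rewrite ler_expR.
  have : 0 <= b * v by rewrite mulr_ge0// ltW.
  lra.
Qed.

Lemma upper_gamma_mixture (rho y : R) : 0 < rho -> rho < 1 -> 0 < y ->
  (\int[mu]_v gumbel (1 - rho) v) * upper_gamma rho y =
  \int[mu]_v gamma_weight (1 - rho) y v.
Proof.
move=> r0 r1 y0; set b := 1 - rho.
have b0 : 0 < b by rewrite subr_gt0.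
have b1 : b <= 1 by rewrite /b; lra.
have Cfin := integrable_fin_num measurableT (integrable_gumbel b0 b1).
have Jfin := integrable_fin_num measurableT (integrable_gamma_weight b0 b1 y0).
have C0 := gumbel_integral_gt0 b0 b1.
have E := integral_gamma_mixture b0 y0.
have -> : upper_gamma rho y = \int[mu]_(w in `[y, +oo[) (expR (- w) * w `^ (- b)).
  by rewrite /upper_gamma; apply: eq_Rintegral => w _; rewrite /b opprB.
rewrite /Rintegral -E.
have CE : (\int[mu]_v (gumbel b v)%:E)%E = (\int[mu]_v gumbel b v)%:E by rewrite fineK.
rewrite -/(\int[mu]_v gumbel b v).
rewrite -fineM//.
set I := (\int[mu]_(w in `[y, +oo[) _)%E in E *.
have I0 : (0 <= I)%E.
  by apply: integral_ge0 => w _; rewrite lee_fin mulr_ge0 ?expR_ge0 ?powR_ge0.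
(* Finiteness of the Gamma integral is read off the mixture: an infinite value times a positive
   constant would be infinite. *)
rewrite ge0_fin_numE// ltey; apply/eqP => Ioo.
move: Jfin; rewrite -E CE Ioo; rewrite gt0_muley// lte_fin//.
Qed.

Definition grey_char (rho theta : R) (f : schwartz R) : R :=
  upper_gamma rho (theta + 2^-1 * schwartz_inner f f) / upper_gamma rho theta.

(** The Gaussian inequality is integrated against the weight at theta. Squares do not commute with
    the mixture, so the square of the left-hand sum A at v is bounded below by its tangent 2 l A -
    l^2 at the mean l, which is affine in A. *)
Lemma gamma_kernel_cos_le (rho theta : R) (h : tempered R) (c : R) (s : seq (R * schwartz R)) :
  0 < rho -> rho < 1 -> 0 < theta -> 0 < c ->
  (forall f, h f ^+ 2 <= c * schwartz_inner f f) -> 0 < upper_gamma rho theta ->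
  (\sum_(u <- s) u.1 * (cos (h u.2) * grey_char rho theta u.2)) ^+ 2 <=
  expR c * qform (fun f g => grey_char rho theta (f - g)) s.
Proof.
move=> r0 r1 t0 c0 hc G0; set L := grey_char rho theta; set b := 1 - rho.
have b0 : 0 < b by rewrite subr_gt0.
have b1 : b <= 1 by rewrite /b; lra.
pose C := \int[mu]_v gumbel b v; have C0 : 0 < C by exact: gumbel_integral_gt0.
pose p f : R := 2^-1 * schwartz_inner f f.
have tp f : 0 < theta + p f by rewrite ltr_pwDl// mulr_ge0 ?invr_ge0// schwartz_inner_ge0.
pose J y := \int[mu]_v gamma_weight b y v.
have iJ f := integrable_gamma_weight b0 b1 (tp f).
have iJ0 := integrable_gamma_weight b0 b1 t0.
have JL f : J (theta + p f) = C * upper_gamma rho theta * L f.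
  by rewrite /J -upper_gamma_mixture// -/C /L /grey_char -/(p f); field; rewrite gt_eqF.
have J0 : J theta = C * upper_gamma rho theta by rewrite /J -upper_gamma_mixture.
set l := \sum_(u <- s) _; set Q := qform _ s.
have key : 2 * l * l - l ^+ 2 <= expR c * Q.
  rewrite -(ler_pM2l (mulr_gt0 C0 G0)).
  have -> : C * upper_gamma rho theta * (2 * l * l - l ^+ 2) =
     \int[mu]_v (\sum_(u <- s) (2 * l * (u.1 * cos (h u.2))) * gamma_weight b (theta + p u.2) v
       - l ^+ 2 * gamma_weight b theta v).
    rewrite RintegralB//; last 2 first.
    - by apply: integrable_sum_EFin => u; exact: integrableZl_EFin.
    - exact: integrableZl_EFin.
    rewrite Rintegral_sum; last by move=> u; exact: integrableZl_EFin.
    rewrite RintegralZl// -/(J theta) J0 mulrBr; congr (_ - _); last by rewrite mulrC.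
    rewrite mulrA {2}/l mulr_sumr; apply: eq_bigr => u _.
    by rewrite RintegralZl// -/(J _) JL; ring.
  have -> : C * upper_gamma rho theta * (expR c * Q) =
     \int[mu]_v (expR c * \sum_(u <- s) \sum_(w <- s) (u.1 * w.1) * gamma_weight b (theta + p (u.2 - w.2)) v).
    have i2 u : mu.-integrable setT (EFin \o (fun v =>
        \sum_(w <- s) (u.1 * w.1) * gamma_weight b (theta + p (u.2 - w.2)) v)).
      by apply: integrable_sum_EFin => w; exact: integrableZl_EFin.
    rewrite RintegralZl//; last exact: integrable_sum_EFin.
    rewrite mulrCA Rintegral_sum//; congr (_ * _).
    rewrite mulr_sumr; apply: eq_bigr => u _.
    rewrite Rintegral_sum; last by move=> w; exact: integrableZl_EFin.
    rewrite mulr_sumr; apply: eq_bigr => w _.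
    by rewrite RintegralZl// -/(J _) JL; ring.
  apply: le_Rintegral => //.
  - have := integrableB measurableT (integrable_sum_EFin s (fun u : R * schwartz R =>
      integrableZl_EFin (2 * l * (u.1 * cos (h u.2))) (iJ u.2))) (integrableZl_EFin (l ^+ 2) iJ0).
    exact.
  - apply: integrableZl_EFin; apply: integrable_sum_EFin => u.
    by apply: integrable_sum_EFin => w; exact: integrableZl_EFin.
  move=> v _; pose k := 1 + expR v.
  have k1 : 1 <= k by rewrite lerDl expR_ge0.
  pose A := \sum_(u <- s) u.1 * (cos (h u.2) * expR (- k * p u.2)).
  pose B := qform (fun f g => expR (- k * p (f - g))) s.
  have AB : A ^+ 2 <= expR c * B by exact: gauss_kernel_cos_le.
  have EA t : \sum_(u <- s) 2 * t * (u.1 * cos (h u.2)) * gamma_weight b (theta + p u.2) v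
      - t ^+ 2 * gamma_weight b theta v = gamma_weight b theta v * (2 * t * A - t ^+ 2).
    rewrite mulrBr [_ * t ^+ 2]mulrC; congr (_ - _).
    rewrite mulrA /A mulr_sumr; apply: eq_bigr => u _.
    by rewrite gamma_weightD; ring.
  rewrite EA.
  have -> : \sum_(u <- s) \sum_(w <- s) u.1 * w.1 * gamma_weight b (theta + p (u.2 - w.2)) v
      = gamma_weight b theta v * B.
    rewrite /B /qform mulr_sumr; apply: eq_bigr => u _; rewrite mulr_sumr; apply: eq_bigr => w _.
    by rewrite gamma_weightD; ring.
  rewrite mulrCA ler_wpM2l ?gamma_weight_ge0// (le_trans _ AB)//.
  have := sqr_ge0 (A - l); rewrite sqrrB mulr2n; lra.
by apply: le_trans key; rewrite expr2; lra.
Qed.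

End GammaKernel.

(** * Density of trigonometric polynomials *)

Section BoundedMeasurable.
Context d {T : measurableType d} {R : realType} (nu : probability T R).
Implicit Types (F G : T -> R).

Definition bounded_measurable F :=
  measurable_fun setT F /\ exists M, forall x, `|F x| <= M.

Lemma bounded_measurable_integrable F : bounded_measurable F ->
  nu.-integrable setT (EFin \o F).
Proof.
move=> [mF [M FM]]; apply: measurable_bounded_integrable => //.
  by apply: le_lt_trans (probability_le1 nu measurableT) _; rewrite ltry.
exists M; split; first exact: num_real.
by move=> r /ltW Mr x _; exact: le_trans Mr.
Qed.

Lemma bounded_measurable_cst a : bounded_measurable (cst a).
Proof. by split => //; exists `|a|. Qed.

Lemma bounded_measurableD F G : bounded_measurable F -> bounded_measurable G ->
  bounded_measurable (fun x => F x + G x).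
Proof.
move=> [mF [M FM]] [mG [N GN]]; split; first exact: measurable_funD.
by exists (M + N) => x; rewrite (le_trans (ler_normD _ _))// lerD.
Qed.

Lemma bounded_measurableM F G : bounded_measurable F -> bounded_measurable G ->
  bounded_measurable (fun x => F x * G x).
Proof.
move=> [mF [M FM]] [mG [N GN]]; split; first exact: measurable_funM.
by exists (M * N) => x; rewrite normrM ler_pM.
Qed.

Lemma bounded_measurableZ a F : bounded_measurable F ->
  bounded_measurable (fun x => a * F x).
Proof. exact/bounded_measurableM/bounded_measurable_cst. Qed.

Lemma bounded_measurableB F G : bounded_measurable F -> bounded_measurable G ->
  bounded_measurable (fun x => F x - G x).
Proof.
move=> bF bG; have := bounded_measurableD bF (bounded_measurableZ (-1) bG).
by under eq_fun do rewrite mulN1r.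
Qed.

Lemma bounded_measurableX F n : bounded_measurable F ->
  bounded_measurable (fun x => F x ^+ n).
Proof.
move=> bF; elim: n => [|n IH]; first exact: bounded_measurable_cst.
by under eq_fun do rewrite exprS; exact: bounded_measurableM.
Qed.

Lemma bounded_measurable_sum (I : Type) (s : seq I) (F : I -> T -> R) :
  (forall i, bounded_measurable (F i)) ->
  bounded_measurable (fun x => \sum_(i <- s) F i x).
Proof.
move=> bF; elim: s => [|i s IH].
  by under eq_fun do rewrite big_nil; exact: bounded_measurable_cst.
by under eq_fun do rewrite big_cons; exact: bounded_measurableD.
Qed.

Lemma sqr_expectation_le F : bounded_measurable F ->
  (\int[nu]_x F x) ^+ 2 <= \int[nu]_x (F x ^+ 2).
Proof.
move=> bF; set m := \int[nu]_x F x.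
have : 0 <= \int[nu]_x ((F x - m) ^+ 2) by apply: Rintegral_ge0 => x _; exact: sqr_ge0.
have -> : \int[nu]_x ((F x - m) ^+ 2) = \int[nu]_x (F x ^+ 2 + (- (2 * m) * F x + m ^+ 2)).
  by apply: eq_Rintegral => x _; ring.
rewrite RintegralD//; last 2 first.
- exact/bounded_measurable_integrable/bounded_measurableX.
- apply: bounded_measurable_integrable; apply: bounded_measurableD.
    exact: bounded_measurableZ.
  exact: bounded_measurable_cst.
rewrite RintegralD//; last 2 first.
- exact/bounded_measurable_integrable/bounded_measurableZ.
- exact/bounded_measurable_integrable/bounded_measurable_cst.
rewrite RintegralZl//; last exact: bounded_measurable_integrable.
rewrite Rintegral_cst// -/m.
have -> : fine (nu setT) = 1 by rewrite probability_setT.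
rewrite mulr1; lra.
Qed.

Lemma bounded_cvg (F : nat -> T -> R) G (M : R) :
  (forall n, measurable_fun setT (F n)) -> (forall n x, `|F n x| <= M) ->
  (forall x, F n x @[n --> \oo] --> G x) -> bounded_measurable G.
Proof.
move=> mF FM FG; split.
  by apply: (measurable_fun_cvg mF) => x _; exact: FG.
exists M => x; rewrite ler_norml -[X in X && _]subr_ge0 -[X in _ && X]subr_ge0 opprK.
apply/andP; split.
  apply: (@cvg_ge0 _ (fun n => F n x + M)); first by apply: cvgD; [exact: FG|exact: cvg_cst].
  by move=> n; have := FM n x; rewrite ler_norml => /andP[h _]; rewrite -lerBlDr sub0r.
apply: (@cvg_ge0 _ (fun n => M - F n x)); first by apply: cvgB; [exact: cvg_cst|exact: FG].
by move=> n; rewrite subr_ge0 (le_trans (ler_norm _)).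
Qed.

Lemma bounded_cvg_Rintegral (F : nat -> T -> R) G (M : R) :
  (forall n, measurable_fun setT (F n)) -> (forall n x, `|F n x| <= M) ->
  (forall x, F n x @[n --> \oo] --> G x) ->
  \int[nu]_x F n x @[n --> \oo] --> \int[nu]_x G x.
Proof.
move=> mF FM FG; have bG := bounded_cvg mF FM FG.
apply: fine_cvg.
rewrite fineK; last exact: integrable_fin_num (bounded_measurable_integrable bG).
apply: (@dominated_cvg _ _ _ nu _ measurableT _ _ (EFin \o cst M)).
- by move=> n; apply/measurable_EFinP; exact: mF.
- by move=> x _; apply: cvg_EFin; [exact: nearW|exact: FG].
- by [].
- exact/bounded_measurable_integrable/bounded_measurable_cst.
- by move=> n x _; rewrite lee_fin.
Qed.

End BoundedMeasurable.

(** * Approximation in L^2 under several image measures at once *)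

Section Approximable.
Context d {T : measurableType d} {R : realType} (nu : probability T R).
Context (maps : seq (T -> T)) (alg : set (T -> R)).
Context (measurable_maps : forall i, measurable_fun setT (nth id maps i)).
Context (alg_cst : forall a, alg (cst a)).
Context (alg_linear : forall a f g, alg f -> alg g -> alg (fun x => a * f x + g x)).
Context (alg_bounded : forall f, alg f -> bounded_measurable f).
Implicit Types (F G : T -> R).

(** The integral against the sum of the images of [nu] under the maps: one approximant serves all of
    them. *)
Definition shifted_integral F : R :=
  \sum_(i < size maps) \int[nu]_x F (nth id maps i x).

Definition approximable F := bounded_measurable F /\
  forall e : R, 0 < e ->
    exists2 f, alg f & shifted_integral (fun x => (F x - f x) ^+ 2) <= e.

Lemma bounded_measurable_map F i : bounded_measurable F ->
  bounded_measurable (fun x => F (nth id maps i x)).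
Proof.
move=> [mF [M FM]]; split; last by exists M.
exact: measurableT_comp.
Qed.

Lemma shifted_integral_le F G : bounded_measurable F -> bounded_measurable G ->
  (forall x, F x <= G x) -> shifted_integral F <= shifted_integral G.
Proof.
move=> bF bG FG; apply: ler_sum => i _; apply: le_Rintegral => //;
  exact/bounded_measurable_integrable/bounded_measurable_map.
Qed.

Lemma shifted_integral_linear a F G : bounded_measurable F -> bounded_measurable G ->
  shifted_integral (fun x => a * F x + G x) = a * shifted_integral F + shifted_integral G.
Proof.
move=> bF bG; rewrite /shifted_integral mulr_sumr -big_split; apply: eq_bigr => i _ /=.
have iF := bounded_measurable_integrable nu (bounded_measurable_map i bF).
have iG := bounded_measurable_integrable nu (bounded_measurable_map i bG).
by rewrite RintegralD// ?RintegralZl//; exact: integrableZl_EFin.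
Qed.

Lemma approximable_alg f : alg f -> approximable f.
Proof.
move=> af; split => [|e e0]; first exact: alg_bounded.
exists f => //; rewrite /shifted_integral big1 ?ltW// => i _.
rewrite (@eq_Rintegral _ _ _ _ _ (cst 0)); last by move=> x _; rewrite subrr expr0n.
by rewrite Rintegral_cst// mul0r.
Qed.

Lemma approximable_linear a F G : approximable F -> approximable G ->
  approximable (fun x => a * F x + G x).
Proof.
move=> [bF aF] [bG aG]; split=> [|e e0].
  by apply: bounded_measurableD => //; exact: bounded_measurableZ.
(* The square of a sum is at most twice the sum of the squares, so each of the two errors ends up at
   most e / 2. *)
have d1 : 0 < e / (4 * (a ^+ 2 + 1)).
  by rewrite divr_gt0// mulr_gt0// ltr_wpDl// sqr_ge0.
have d2 : 0 < e / 4 by rewrite divr_gt0.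
have [f af Ff] := aF _ d1; have [g ag Gg] := aG _ d2.
exists (fun x => a * f x + g x); first exact: alg_linear.
have bFf := bounded_measurableX 2 (bounded_measurableB bF (alg_bounded af)).
have bGg := bounded_measurableX 2 (bounded_measurableB bG (alg_bounded ag)).
have b2 := bounded_measurableZ 2 bGg.
apply: (@le_trans _ _ (shifted_integral (fun x =>
    (2 * a ^+ 2) * (F x - f x) ^+ 2 + 2 * (G x - g x) ^+ 2))).
  apply: shifted_integral_le.
  - apply: bounded_measurableX; apply: bounded_measurableB.
      by apply: bounded_measurableD => //; exact: bounded_measurableZ.
    by apply: alg_bounded; exact: alg_linear.
  - by apply: bounded_measurableD => //; exact: bounded_measurableZ.
  - by move=> x; have := sqr_ge0 (a * (F x - f x) - (G x - g x)); lra.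
rewrite shifted_integral_linear//.
have := shifted_integral_linear 2 bGg (bounded_measurable_cst 0).
under eq_fun do rewrite addr0; move=> ->.
have -> : shifted_integral (cst 0) = 0.
  by rewrite /shifted_integral big1// => i _; rewrite Rintegral_cst// mul0r.
rewrite addr0.
have : 2 * a ^+ 2 * shifted_integral (fun x => (F x - f x) ^+ 2) <=
    2 * a ^+ 2 * (e / (4 * (a ^+ 2 + 1))) by rewrite ler_wpM2l// mulr_ge0// sqr_ge0.
have : 2 * a ^+ 2 * (e / (4 * (a ^+ 2 + 1))) <= e / 2.
  rewrite mulrA ler_pdivrMr; last by rewrite mulr_gt0// ltr_wpDl// sqr_ge0.
  have : 0 <= e by exact: ltW.
  have -> : e / 2 * (4 * (a ^+ 2 + 1)) = 2 * a ^+ 2 * e + 2 * e by field.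
  lra.
move: Gg; lra.
Qed.

Lemma approximable_lim (Fn : nat -> T -> R) F (M : R) :
  (forall n, approximable (Fn n)) -> (forall n x, `|Fn n x| <= M) ->
  (forall x, Fn n x @[n --> \oo] --> F x) -> approximable F.
Proof.
move=> aFn FM FF; have mFn n : measurable_fun setT (Fn n) by have [[]] := aFn n.
have bF := bounded_cvg mFn FM FF; split=> [//|e e0].
have cv : shifted_integral (fun x => (F x - Fn n x) ^+ 2) @[n --> \oo] --> 0.
  have -> : 0 = \sum_(i < size maps) \int[nu]_x (cst 0 : T -> R) (nth id maps i x).
    by rewrite big1// => i _; rewrite Rintegral_cst// mul0r.
  apply: cvg_sum_seq => i; have [_ [N FN]] := bF.
  apply: (@bounded_cvg_Rintegral _ _ _ nu _ _ ((N + M) ^+ 2)).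
  - move=> n; have [] // : bounded_measurable (fun x => (F (nth id maps i x) - Fn n (nth id maps i x)) ^+ 2).
    apply: bounded_measurableX; apply: bounded_measurableB; apply: bounded_measurable_map => //.
    by have [] := aFn n.
  - move=> n x; have := sqr_ge0 (F (nth id maps i x) - Fn n (nth id maps i x)).
    move=> /ger0_norm ->; rewrite -real_normK ?num_real// ler_pXn2r ?nnegrE//.
      by rewrite (le_trans (ler_normB _ _))// lerD.
    by rewrite addr_ge0//; [exact: le_trans (FN x)|exact: le_trans (FM n x)].
  - move=> x; set y := nth id maps i x.
    have -> : cst 0 y = (F y - F y) * (F y - F y) :> R by rewrite subrr mulr0.
    under eq_fun do rewrite expr2.
    by apply: cvgM; (apply: cvgB; [exact: cvg_cst|exact: FF]).
have e4 : 0 < e / 4 by rewrite divr_gt0.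
have /cvgrPdist_lt/(_ _ e4)[n _ /(_ n (leqnn n)) /=] := cv.
rewrite sub0r normrN => /ltW/(le_trans (ler_norm _)) h1.
have [_ /(_ _ e4)[f af h2]] := aFn n.
exists f => //.
have b1 := bounded_measurableX 2 (bounded_measurableB bF (proj1 (aFn n))).
have b2 := bounded_measurableX 2 (bounded_measurableB (proj1 (aFn n)) (alg_bounded af)).
apply: (@le_trans _ _ (shifted_integral (fun x => 2 * (F x - Fn n x) ^+ 2 +
   (2 * (Fn n x - f x) ^+ 2 + 0)))).
  apply: shifted_integral_le.
  - by apply: bounded_measurableX; apply: bounded_measurableB => //; exact: alg_bounded.
  - apply: bounded_measurableD; first exact: bounded_measurableZ.
    by apply: bounded_measurableD; [exact: bounded_measurableZ|exact: bounded_measurable_cst].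
  - by move=> x; have := sqr_ge0 ((F x - Fn n x) - (Fn n x - f x)); lra.
rewrite shifted_integral_linear//; last first.
  by apply: bounded_measurableD; [exact: bounded_measurableZ|exact: bounded_measurable_cst].
rewrite (shifted_integral_linear 2 b2 (bounded_measurable_cst 0)).
have -> : shifted_integral (cst 0) = 0.
  by rewrite /shifted_integral big1// => i _; rewrite Rintegral_cst// mul0r.
lra.
Qed.

(** Dynkin's argument: linearity gives proper differences, bounded limits give increasing unions. *)
Lemma approximable_sigma_algebra (G : set (set T)) : setI_closed G ->
  (forall A, G A -> measurable A /\ approximable \1_A) ->
  forall A, <<s G >> A -> approximable \1_A.
Proof.
move=> IG GL A sA.
suff /(_ A sA)[] : <<s G >> `<=` [set A | measurable A /\ approximable \1_A] by [].
apply: (lambda_system_subset IG) => //; last first.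
split=> //.
- split; first exact: measurableT.
  by rewrite indicT; apply: approximable_alg; exact: alg_cst.
- move=> B C CB [mB aB] [mC aC]; split; first exact: measurableD.
  have := approximable_linear (-1) aC aB; congr approximable; apply/funext => x.
  rewrite !indicE in_setD; case: (boolP (x \in C)) => xC; case: (boolP (x \in B)) => xB /=; rewrite ?mulN1r ?addNr ?oppr0 ?add0r//.
  by move: xC xB => /set_mem/CB/mem_set ->.
- move=> B ndB LB; have mB n : measurable (B n) by have [] := LB n.
  split; first exact: bigcup_measurable.
  apply: (@approximable_lim (fun n => \1_(B n)) _ 1) => [n|n x|x].
  + by have [] := LB n.
  + by rewrite indicE; case: (_ \in _); rewrite ?normr1 ?normr0.
  + have [[n _ Bn]|nB] := pselect ((\bigcup_i B i) x).
      apply: cvg_near_cst; exists n => // k /= nk.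
      rewrite !indicE !mem_set//; first by exists n.
      by move: ndB => /(_ _ _ nk)/subsetPset; exact.
    apply: cvg_near_cst; exists 0%N => // k _.
    rewrite !indicE !memNset// => Bk; apply: nB; exists k => //.
Qed.

End Approximable.

(** * Polynomial iterations converging to the sign *)

Section SignPolynomial.
Context {R : realType}.

(** The Newton-Schulz iteration for the sign. It is polynomial, hence preserves any algebra of
    functions. *)
Definition sign_step (z : R) : R := 2^-1 * (3 * z - z * (z * z)).
Definition sign_iter n (z : R) : R := iter n sign_step z.

(* [sign_iter n] tends to the sign function pointwise on [-1, 1]. *)
Definition step_approx n (z : R) : R :=
  2^-1 * (sign_iter n z + sign_iter n z * sign_iter n z).

Lemma sign_iterN n z : sign_iter n (- z) = - sign_iter n z.
Proof.
elim: n => [//|n IH]; rewrite /sign_iter !iterS -!/(sign_iter n _) IH /sign_step; ring.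
Qed.

Lemma sign_iter_bound n z : `|z| <= 1 -> `|sign_iter n z| <= 1.
Proof.
move=> z1; elim: n => [//|n]; rewrite /sign_iter iterS -/(sign_iter n z).
set w := sign_iter n z; rewrite !ler_norml /sign_step => /andP[w1 w2].
(* Halved, these two products are 1 - [sign_step] w and 1 + [sign_step] w. *)
have h1 : 0 <= (1 - w) ^+ 2 * (2 + w) by rewrite mulr_ge0 ?sqr_ge0//; lra.
have h2 : 0 <= (1 + w) ^+ 2 * (2 - w) by rewrite mulr_ge0 ?sqr_ge0//; lra.
by apply/andP; split; lra.
Qed.

Lemma sign_iter_cvg (z : R) : 0 < z -> z <= 1 -> sign_iter n z @[n --> \oo] --> (1 : R).
Proof.
move=> z0 z1; pose k := 1 - z / 2.
have H n : z <= sign_iter n z /\ 0 <= 1 - sign_iter n z <= k ^+ n.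
  elim: n => [|n [zw /andP[w1 wk]]].
    by split => //; rewrite expr0 /sign_iter/=; apply/andP; split; lra.
  rewrite /sign_iter iterS -/(sign_iter n z) exprS; move: zw w1 wk.
  set w := sign_iter n z => zw w1 wk; rewrite /sign_step.
  have e : 1 - 2^-1 * (3 * w - w * (w * w)) = (1 - w) * ((1 - w) * (2 + w) / 2) by field.
  have c0 : 0 <= (1 - w) * (2 + w) / 2 by rewrite divr_ge0// mulr_ge0//; lra.
  have ck : (1 - w) * (2 + w) / 2 <= k.
    rewrite /k; have : 0 <= w ^+ 2 by exact: sqr_ge0.
    by rewrite expr2; lra.
  split; last first.
    by rewrite e mulr_ge0//= mulrC ler_pM.
  apply: (le_trans zw); nra.
have cvk : k ^+ n @[n --> \oo] --> (0 : R).
  by apply: cvg_expr; rewrite /k ger0_norm; lra.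
have c1 : (1 - k ^+ n) @[n --> \oo] --> (1 : R).
  by rewrite -[X in _ --> X](subr0 1); apply: cvgB => //; exact: cvg_cst.
apply: (squeeze_cvgr (h := cst 1) _ c1 (cvg_cst _)).
apply: nearW => n; have [_ /andP[a b]] := H n; rewrite /cst/=; apply/andP; split; lra.
Qed.

Lemma step_approx_bound n z : `|z| <= 1 -> `|step_approx n z| <= 1.
Proof.
move=> /(sign_iter_bound n); rewrite /step_approx !ler_norml => /andP[a b].
by apply/andP; split; nra.
Qed.

(** The polynomial (l + l^2) / 2 sends the limits 1, 0, -1 to 1, 0, 0, which suits the strict
    inequality. *)
Lemma step_approx_cvg z : `|z| <= 1 -> step_approx n z @[n --> \oo] --> ((0 < z)%R%:R : R).
Proof.
move=> z1; have lim l : sign_iter n z @[n --> \oo] --> l ->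
    step_approx n z @[n --> \oo] --> 2^-1 * (l + l * l).
  by move=> cl; apply: cvgMl_tmp; apply: cvgD => //; exact: cvgM.
move: z1; rewrite ler_norml => /andP[z1 z2]; have [z0|z0|z0] := ltgtP 0 z.
- by have := lim _ (sign_iter_cvg z0 z2); have -> : 2^-1 * (1 + 1 * 1) = true%:R :> R by rewrite /=; field.
- have c : sign_iter n z @[n --> \oo] --> (-1 : R).
    rewrite -[z]opprK; under eq_fun do rewrite sign_iterN.
    by apply: cvgN; apply: sign_iter_cvg; [rewrite oppr_gt0|rewrite lerNl].
  by have := lim _ c; have -> : 2^-1 * (-1 + -1 * -1) = false%:R :> R by rewrite mulN1r opprK addNr mulr0.
- have c : sign_iter n z @[n --> \oo] --> (0 : R).
    have -> : sign_iter^~ z = cst 0; last exact: cvg_cst.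
    apply/funext => n; have := sign_iterN n 0; rewrite oppr0 -z0 /cst/= => h; lra.
  by have := lim _ c; have -> : 2^-1 * (0 + 0 * 0) = false%:R :> R by rewrite mulr0 addr0 mulr0.
Qed.

Lemma sin_small_gt0 (y t : R) : 0 < t -> `|y| * t < pi -> (0 < sin (y * t)) = (0 < y).
Proof.
move=> t0; have [y0|y0|<-] := ltgtP 0 y.
- rewrite gtr0_norm// => yp; apply: sin_gt0_pi; rewrite yp andbT; exact: mulr_gt0.
- rewrite ltr0_norm// => yp; apply/negbTE; rewrite -leNgt -oppr_ge0 -sinN -mulNr.
  by apply: sin_ge0_pi; rewrite mulr_ge0 ?(ltW t0) ?oppr_ge0 ?(ltW y0)//= ltW.
- by rewrite mul0r sin0 ltxx.
Qed.

End SignPolynomial.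

(** * The algebra of trigonometric polynomials on tempered distributions *)

Section TrigPolynomials.
Context {R : realType}.
Implicit Types (x : tempered_measurable R) (xi : schwartz R).
Local Notation T := (tempered_measurable R).

(** The phase [u.2.1] lets cosines alone express sines as well. *)
Definition trig (s : seq (R * (R * schwartz R))) x : R :=
  \sum_(u <- s) u.1 * cos ((x : tempered R) u.2.2 + u.2.1).

Definition trigonometric : set (T -> R) := range trig.

Lemma trigonometric_cos (c : R) xi : trigonometric (fun x : T => cos ((x : tempered R) xi + c)).
Proof.
exists [:: (1, (c, xi))] => //; apply/funext => x.
by rewrite /trig big_cons big_nil addr0 mul1r.
Qed.

Lemma trigonometric_cst a : trigonometric (cst a).
Proof.
exists [:: (a, (0, 0))] => //; apply/funext => x.
by rewrite /trig big_cons big_nil addr0 /= tempered0 addr0 cos0 mulr1.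
Qed.

Lemma trigonometric_linear a f g : trigonometric f -> trigonometric g ->
  trigonometric (fun x => a * f x + g x).
Proof.
move=> [s _ <-] [t _ <-]; exists ([seq (a * u.1, u.2) | u <- s] ++ t) => //.
apply/funext => x; rewrite /trig big_cat big_map mulr_sumr; congr (_ + _).
by apply: eq_bigr => u _; rewrite mulrA.
Qed.

Lemma trigonometricZ a f : trigonometric f -> trigonometric (fun x => a * f x).
Proof.
move=> tf; have := trigonometric_linear a tf (trigonometric_cst 0).
by under eq_fun do rewrite addr0.
Qed.

Lemma trigonometricD f g : trigonometric f -> trigonometric g ->
  trigonometric (fun x => f x + g x).
Proof.
move=> tf tg; have := trigonometric_linear 1 tf tg.
by under eq_fun do rewrite mul1r.
Qed.

Lemma cosM (a b : R) : cos a * cos b = 2^-1 * (cos (a + b) + cos (a - b)).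
Proof. by rewrite cosD cosB; field. Qed.

Lemma trigonometric_cosM (c : R) xi g : trigonometric g ->
  trigonometric (fun x => cos ((x : tempered R) xi + c) * g x).
Proof.
move=> [t _ <-].
exists ([seq (2^-1 * u.1, (c + u.2.1, xi + u.2.2)) | u <- t] ++
        [seq (2^-1 * u.1, (c - u.2.1, xi - u.2.2)) | u <- t]) => //.
apply/funext => x; rewrite /trig big_cat /= !big_map -big_split mulr_sumr.
apply: eq_bigr => u _ /=; rewrite mulrCA cosM temperedD temperedB.
rewrite [x xi + c + (_ + _)]addrACA [- (x u.2.2 + _)]opprD [x xi + c + (- _ - _)]addrACA; ring.
Qed.

Lemma trigonometricM f g : trigonometric f -> trigonometric g ->
  trigonometric (fun x => f x * g x).
Proof.
move=> [s _ <-] tg; elim: s => [|u s IH].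
  rewrite (_ : (fun _ => _) = cst 0); first exact: trigonometric_cst.
  by apply/funext => x; rewrite /trig big_nil mul0r.
have := trigonometric_linear u.1 (trigonometric_cosM u.2.1 u.2.2 tg) IH.
congr trigonometric; apply/funext => x.
by rewrite /trig big_cons mulrDl mulrA.
Qed.

Lemma trigonometric_prod (I : Type) (s : seq I) (F : I -> T -> R) :
  (forall i, trigonometric (F i)) -> trigonometric (fun x => \prod_(i <- s) F i x).
Proof.
move=> tF; elim: s => [|i s IH].
  by under eq_fun do rewrite big_nil; exact: trigonometric_cst.
by under eq_fun do rewrite big_cons; exact: trigonometricM.
Qed.

Lemma trigonometric_step n f : trigonometric f -> trigonometric (fun x => step_approx n (f x)).
Proof.
move=> tf; have ti : trigonometric (fun x => sign_iter n (f x)).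
  elim: n => [//|n IH].
  apply: trigonometricZ.
  have := trigonometric_linear (-1) (trigonometricM IH (trigonometricM IH IH)) (trigonometricZ 3 IH).
  by congr trigonometric; apply/funext => x; rewrite mulN1r addrC.
by apply: trigonometricZ; apply: trigonometricD => //; exact: trigonometricM.
Qed.

Lemma bounded_measurable_cos (c : R) xi :
  bounded_measurable (fun x : T => cos ((x : tempered R) xi + c)).
Proof.
split; last by exists 1 => x; rewrite ler_norml cos_geN1 cos_le1.
apply: measurableT_comp.
  by apply: continuous_measurable_fun; exact: continuous_cos.
by apply: measurable_funD => //; exact: measurable_tempered_eval.
Qed.

Lemma trigonometric_bounded f : trigonometric f -> bounded_measurable f.
Proof.
move=> [s _ <-]; apply: bounded_measurable_sum => u.
exact/bounded_measurableZ/bounded_measurable_cos.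
Qed.

(** Finite intersections of open half-spaces: a generating pi-system whose indicators are products
    of one-dimensional steps. *)
Definition half_spaces (s : seq (schwartz R * R)) : set T :=
  [set x | all (fun u => u.2 < (x : tempered R) u.1) s].

Lemma half_spaces_setI : setI_closed (range half_spaces).
Proof.
move=> _ _ [s _ <-] [t _ <-]; exists (s ++ t) => //.
by apply/seteqP; split => x; rewrite /half_spaces/= all_cat => /andP.
Qed.

Lemma indic_half_spaces s x :
  \1_(half_spaces s) x = \prod_(u <- s) ((u.2 < (x : tempered R) u.1)%R%:R : R).
Proof.
rewrite indicE; have -> : (x \in half_spaces s) = all (fun u => u.2 < (x : tempered R) u.1) s.
  by apply/idP/idP => [/set_mem|?]//; exact/mem_set.
elim: s => [|u s IH]; first by rewrite big_nil.
by rewrite big_cons -IH /=; case: (_ < _); rewrite ?mul1r ?mul0r.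
Qed.

Lemma measurable_half_spaces s : measurable (half_spaces s).
Proof.
elim: s => [|u s IH].
  rewrite (_ : half_spaces _ = setT)//; by apply/seteqP; split.
have -> : half_spaces (u :: s) =
    (fun x : T => (x : tempered R) u.1) @^-1` `]u.2, +oo[ `&` half_spaces s.
  apply/seteqP; split => x; rewrite /half_spaces /= in_itv/= andbT; first by move=> /andP.
  by move=> [-> ->].
apply: measurableI => //; rewrite -[X in measurable X]setTI.
by apply: measurable_tempered_eval => //; exact: measurable_itv.
Qed.

Lemma cylinder_half_spaces : cylinder R `<=` <<s range half_spaces >>.
Proof.
pose S := g_sigma_algebraType (range half_spaces).
have mev xi : measurable_fun setT (fun x : S => (x : tempered R) xi).
  apply: (measurability _ (RGenOInfty.measurableE R)).
  move=> _ [_ [t ->] <-]; rewrite setTI; apply: sub_sigma_algebra.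
  exists [:: (xi, t)] => //; apply/seteqP; split => x /=; rewrite /half_spaces /= andbT in_itv/= andbT//.
move=> _ [n [xi [A [mA ->]]]].
have mt : measurable_fun setT (fun x : S => [tuple (x : tempered R) (xi i) | i < n]).
  apply/measurable_fun_tnthP => i.
  rewrite (_ : _ \o _ = (fun x : S => (x : tempered R) (xi i)))//.
  by apply/funext => x /=; rewrite tnth_mktuple.
by have := mt measurableT A mA; rewrite setTI.
Qed.

Lemma measurable_half_spaces_sub (A : set T) : measurable A -> <<s range half_spaces >> A.
Proof.
apply: smallest_sub; first exact: smallest_sigma_algebra.
exact: cylinder_half_spaces.
Qed.

(** Two limits are nested. For fixed m, polynomial steps applied to sin (y / (m + 1)) converge to
    the indicator that this sine is positive. As m grows, y / (m + 1) enters the interval (-pi, pi),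
    where the sine has the sign of y. *)
Lemma approximable_half_spaces (nu : probability T R) (maps : seq (T -> T)) s :
  (forall i, measurable_fun setT (nth id maps i)) ->
  approximable nu maps trigonometric (\1_(half_spaces s)).
Proof.
move=> mm.
pose G (m : nat) (u : schwartz R * R) x : R := sin (((x : tempered R) u.1 - u.2) * m.+1%:R^-1).
have tG m u : trigonometric (G m u).
  have := trigonometric_cos (- (u.2 / m.+1%:R) - pi / 2) (m.+1%:R^-1 *: u.1).
  congr trigonometric; apply/funext => x.
  rewrite temperedZ addrA cosB cos_pihalf sin_pihalf mulr0 add0r mulr1 /G mulrBl.
  by rewrite mulrC.
have G1 m u x : `|G m u x| <= 1 by rewrite ler_norml sin_geN1 sin_le1.
have prod1 (F : schwartz R * R -> R) : (forall u, `|F u| <= 1) -> `|\prod_(u <- s) F u| <= 1.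
  move=> F1; elim: s => [|u s' IH]; first by rewrite big_nil normr1.
  by rewrite big_cons normrM mulr_ile1.
have cvg_prod (F : schwartz R * R -> nat -> R) (L : schwartz R * R -> R) : (forall u, F u n @[n --> \oo] --> L u) ->
    \prod_(u <- s) F u n @[n --> \oo] --> \prod_(u <- s) L u.
  by move=> FL; apply: cvg_big => //; exact: mul_continuous.
apply: (@approximable_lim _ _ _ nu maps trigonometric mm trigonometric_bounded
    (fun m x => \prod_(u <- s) ((0 < G m u x)%R%:R : R)) _ 1) => [m|m x|x].
- apply: (@approximable_lim _ _ _ nu maps trigonometric mm trigonometric_bounded
    (fun n x => \prod_(u <- s) step_approx n (G m u x)) _ 1) => [n|n x|x].
  + apply: approximable_alg; first exact: trigonometric_bounded.
    by apply: trigonometric_prod => u; exact: trigonometric_step.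
  + by apply: prod1 => u; exact: step_approx_bound.
  + by apply: cvg_prod => u; exact: step_approx_cvg.
- by apply: prod1 => u; case: (_ < _); rewrite ?normr1 ?normr0.
- rewrite indic_half_spaces; apply: cvg_prod => u.
  set y := (x : tempered R) u.1 - u.2.
  apply: cvg_near_cst; exists (Num.truncn (`|y| / pi)).+1 => // m /= ym.
  congr (_%:R); rewrite /G -/y sin_small_gt0 ?invr_gt0// ?subr_gt0//.
  rewrite ltr_pdivrMr// -ltr_pdivrMl ?pi_gt0// mulrC.
  by rewrite (lt_trans (truncnS_gt _))// ltr_nat ltnS.
Qed.

Lemma approximable_measurable (nu : probability T R) (maps : seq (T -> T)) (A : set T) :
  (forall i, measurable_fun setT (nth id maps i)) -> measurable A ->
  approximable nu maps trigonometric (\1_A).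
Proof.
move=> mm /measurable_half_spaces_sub.
apply: (approximable_sigma_algebra mm trigonometric_cst trigonometric_linear
  trigonometric_bounded half_spaces_setI).
move=> _ [s _ <-]; split; first exact: measurable_half_spaces.
exact: approximable_half_spaces.
Qed.

End TrigPolynomials.

(** * Quasi-invariance of the grey measure *)

Section GreyMeasure.
Context {R : realType}.
Context (rho theta : R) (nu : probability (tempered_measurable R) R).
Context (rho_gt0 : 0 < rho) (rho_lt1 : rho < 1) (theta_gt0 : 0 < theta).
Context (nu_grey : gamma_grey rho theta nu).
Local Notation T := (tempered_measurable R).
Local Notation L := (grey_char rho theta).
Implicit Types (x : T) (xi : schwartz R).

Lemma measurable_tadd (h : tempered R) : measurable_fun setT (fun x : T => tadd x h : T).
Proof.
apply: (@measurability _ _ T T setT _ (cylinder R) erefl).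
move=> _ [_ [n [xi [A [mA ->]]]] <-]; rewrite setTI.
have mt : measurable_fun setT
    (fun x : T => [tuple (x : tempered R) (xi i) + h (xi i) | i < n]).
  apply/measurable_fun_tnthP => i.
  rewrite (_ : _ \o _ = (fun x : T => (x : tempered R) (xi i) + h (xi i))).
    by apply: measurable_funD => //; exact: measurable_tempered_eval.
  by apply/funext => x /=; rewrite tnth_mktuple.
have := mt measurableT A mA; rewrite setTI; congr measurable.
apply/seteqP; split => x /=; congr A; apply: eq_from_tnth => i;
  by rewrite !tnth_mktuple taddE.
Qed.

Lemma expectation_cos0 xi : \int[nu]_x cos ((x : tempered R) xi) = L xi.
Proof. by have := congr1 (@complex.Re R) (nu_grey xi). Qed.

Lemma expectation_sin0 xi : \int[nu]_x sin ((x : tempered R) xi) = 0.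
Proof. by have := congr1 (@complex.Im R) (nu_grey xi). Qed.

(** If it vanished, division by zero would give characteristic functional 0 at the origin, whereas
    the total mass is 1. *)
Lemma upper_gamma_gt0 : 0 < upper_gamma rho theta.
Proof.
rewrite lt_neqAle; apply/andP; split; last first.
  by apply: Rintegral_ge0 => w _; rewrite mulr_ge0 ?expR_ge0 ?powR_ge0.
apply/eqP => G0; have := expectation_cos0 0.
rewrite /grey_char -G0 invr0 mulr0 (@eq_Rintegral _ _ _ _ _ (cst 1)).
  rewrite Rintegral_cst// mul1r; have -> : fine (nu setT) = 1 by rewrite probability_setT.
  by move/eqP; rewrite oner_eq0.
by move=> x _; rewrite tempered0 cos0.
Qed.

Lemma bounded_measurable_sin xi : bounded_measurable (fun x : T => sin ((x : tempered R) xi)).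
Proof.
have := bounded_measurable_cos (- (pi / 2)) xi.
congr bounded_measurable; apply/funext => x.
by rewrite cosB cos_pihalf sin_pihalf mulr0 add0r mulr1.
Qed.

Lemma bounded_measurable_cos0 xi : bounded_measurable (fun x : T => cos ((x : tempered R) xi)).
Proof.
by have := bounded_measurable_cos 0 xi; under eq_fun do rewrite addr0.
Qed.

Lemma expectation_cos xi (c : R) :
  \int[nu]_x cos ((x : tempered R) xi + c) = cos c * L xi.
Proof.
transitivity (\int[nu]_x (cos c * cos ((x : tempered R) xi) + (- sin c) * sin ((x : tempered R) xi))).
  by apply: eq_Rintegral => x _; rewrite cosD; ring.
have iC := bounded_measurable_integrable nu (bounded_measurable_cos0 xi).
have iS := bounded_measurable_integrable nu (bounded_measurable_sin xi).
rewrite RintegralD//; [|exact: integrableZl_EFin|exact: integrableZl_EFin].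
by rewrite !RintegralZl// expectation_cos0 expectation_sin0 mulr0 addr0.
Qed.

Lemma grey_charN xi : L (- xi) = L xi.
Proof.
rewrite /grey_char; congr (upper_gamma _ (_ + _ * _) / _).
by rewrite -scaleN1r schwartz_innerZ schwartz_innerC schwartz_innerZ !mulN1r opprK.
Qed.

Definition cos_sum (s : seq (R * schwartz R)) x : R :=
  \sum_(u <- s) u.1 * cos ((x : tempered R) u.2).
Definition sin_sum (s : seq (R * schwartz R)) x : R :=
  \sum_(u <- s) u.1 * sin ((x : tempered R) u.2).

Lemma bounded_measurable_cos_sum s : bounded_measurable (cos_sum s).
Proof. by apply: bounded_measurable_sum => u; exact/bounded_measurableZ/bounded_measurable_cos0. Qed.

Lemma bounded_measurable_sin_sum s : bounded_measurable (sin_sum s).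
Proof. by apply: bounded_measurable_sum => u; exact/bounded_measurableZ/bounded_measurable_sin. Qed.

(** The easy half of Bochner's theorem: the right-hand side is the mean squared modulus of the
    complex trigonometric sum. *)
Lemma qform_grey_char s :
  qform (fun f g => L (f - g)) s = \int[nu]_x (cos_sum s x ^+ 2 + sin_sum s x ^+ 2).
Proof.
transitivity (\int[nu]_x (\sum_(u <- s) \sum_(v <- s)
    u.1 * v.1 * cos ((x : tempered R) (u.2 - v.2)))).
  have i u v : nu.-integrable setT (EFin \o (fun x : T => u.1 * v.1 * cos ((x : tempered R) (u.2 - v.2)))).
    exact/integrableZl_EFin/bounded_measurable_integrable/bounded_measurable_cos0.
  rewrite Rintegral_sum; last by move=> u; exact: integrable_sum_EFin.
  apply: eq_bigr => u _; rewrite Rintegral_sum//; apply: eq_bigr => v _.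
  rewrite RintegralZl// ?expectation_cos0//.
  exact/bounded_measurable_integrable/bounded_measurable_cos0.
apply: eq_Rintegral => x _; rewrite !expr2 !big_distrlr -big_split; apply: eq_bigr => u _ /=.
rewrite -big_split; apply: eq_bigr => v _ /=.
by rewrite temperedB cosB; ring.
Qed.

Lemma expectation_cos_sin s t : \int[nu]_x (cos_sum s x * sin_sum t x) = 0.
Proof.
transitivity (\int[nu]_x (\sum_(u <- s) \sum_(v <- t)
    2^-1 * (u.1 * v.1) * (sin ((x : tempered R) (u.2 + v.2)) - sin ((x : tempered R) (u.2 - v.2))))).
  apply: eq_Rintegral => x _; rewrite big_distrlr; apply: eq_bigr => u _ /=.
  apply: eq_bigr => v _ /=.
  by rewrite temperedD temperedB sinD sinB; field.
have i xi := bounded_measurable_integrable nu (bounded_measurable_sin xi).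
have j (u v : R * schwartz R) : nu.-integrable setT (EFin \o (fun x : T =>
    sin ((x : tempered R) (u.2 + v.2)) - sin ((x : tempered R) (u.2 - v.2)))).
  by apply: bounded_measurable_integrable; apply: bounded_measurableB; exact: bounded_measurable_sin.
rewrite Rintegral_sum; last first.
  by move=> u; apply: integrable_sum_EFin => v; exact: integrableZl_EFin.
apply: big1 => u _; rewrite Rintegral_sum; last by move=> v; exact: integrableZl_EFin.
apply: big1 => v _; rewrite RintegralZl// RintegralB// !expectation_sin0.
by rewrite subrr mulr0.
Qed.

(** Sines have mean 0 under [nu], so only the part of the polynomial even in x reaches the left-hand
    side. The odd part can only increase the right-hand side, its product with the even part having
    mean 0. *)
Lemma trig_shift_le (h : tempered R) (c : R) s : 0 < c ->
  (forall f, h f ^+ 2 <= c * schwartz_inner f f) ->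
  (\int[nu]_x (2^-1 * (trig s (tadd x h) + trig s (tadd x (topp h))))) ^+ 2 <=
  expR c * \int[nu]_x (trig s x ^+ 2).
Proof.
move=> c0 hc.
(* The frequencies are doubled into [xi, - xi] so that the sine sums cancel. *)
pose C := [seq (u.1 * cos u.2.1, u.2.2) | u <- s].
pose S := [seq (u.1 * sin u.2.1, u.2.2) | u <- s].
pose s2 := [seq (2^-1 * u.1, u.2) | u <- C] ++ [seq (2^-1 * u.1, - u.2) | u <- C].
have -> : \int[nu]_x (2^-1 * (trig s (tadd x h) + trig s (tadd x (topp h)))) =
    \sum_(u <- s2) u.1 * (cos (h u.2) * L u.2).
  transitivity (\int[nu]_x (\sum_(u <- s) (u.1 * cos (h u.2.2)) * cos ((x : tempered R) u.2.2 + u.2.1))).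
    apply: eq_Rintegral => x _; rewrite /trig -big_split mulr_sumr; apply: eq_bigr => u _ /=.
    rewrite !taddE toppE; set y := (x : tempered R) u.2.2; set z := h u.2.2.
    have -> : y + z + u.2.1 = (y + u.2.1) + z by ring.
    have -> : y - z + u.2.1 = (y + u.2.1) - z by ring.
    by rewrite (cosD (y + u.2.1) z) (cosB (y + u.2.1) z); field.
  rewrite Rintegral_sum; last first.
    by move=> u; exact/integrableZl_EFin/bounded_measurable_integrable/bounded_measurable_cos.
  rewrite /s2 /C big_cat /= !big_map -big_split; apply: eq_bigr => u _ /=.
  rewrite RintegralZl//; last exact/bounded_measurable_integrable/bounded_measurable_cos.
  by rewrite expectation_cos temperedN cosN grey_charN; field.
apply: (le_trans (gamma_kernel_cos_le s2 rho_gt0 rho_lt1 theta_gt0 c0 hc upper_gamma_gt0)).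
rewrite ler_pM2l ?expR_gt0// qform_grey_char.
have cE x : cos_sum s2 x = cos_sum C x.
  rewrite /cos_sum /s2 big_cat /= !big_map -big_split; apply: eq_bigr => u _ /=.
  by rewrite temperedN cosN; field.
have sE x : sin_sum s2 x = 0.
  rewrite /sin_sum /s2 big_cat /= !big_map -big_split; apply: big1 => u _ /=.
  by rewrite temperedN sinN mulrN subrr.
have trigE x : trig s x = cos_sum C x - sin_sum S x.
  rewrite /cos_sum /sin_sum !big_map -sumrB; apply: eq_bigr => u _ /=.
  by rewrite cosD; ring.
have bC := bounded_measurable_cos_sum C; have bS := bounded_measurable_sin_sum S.
rewrite (@eq_Rintegral _ _ _ _ _ (fun x => cos_sum C x ^+ 2)); last first.
  by move=> x _; rewrite cE sE expr0n addr0.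
have -> : \int[nu]_x (trig s x ^+ 2) =
   \int[nu]_x (cos_sum C x ^+ 2 + ((-2) * (cos_sum C x * sin_sum S x) + sin_sum S x ^+ 2)).
  by apply: eq_Rintegral => x _; rewrite trigE; ring.
have iC := bounded_measurable_integrable nu (bounded_measurableX 2 bC).
have iS := bounded_measurable_integrable nu (bounded_measurableX 2 bS).
have iCS := bounded_measurable_integrable nu (bounded_measurableM bC bS).
rewrite RintegralD//; last first.
  apply: bounded_measurable_integrable; apply: bounded_measurableD.
    exact/bounded_measurableZ/bounded_measurableM.
  exact: bounded_measurableX.
rewrite RintegralD//; last exact: integrableZl_EFin.
rewrite RintegralZl// expectation_cos_sin mulr0 add0r lerDl.
by apply: Rintegral_ge0 => x _; exact: sqr_ge0.
Qed.

Lemma Rintegral_indic_preimage (f : T -> T) (A : set T) : measurable_fun setT f ->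
  measurable A -> \int[nu]_x \1_A (f x) = fine (nu (f @^-1` A)).
Proof.
move=> mf mA; have mfA : measurable (f @^-1` A) by rewrite -[X in measurable X]setTI; exact: mf.
rewrite /Rintegral; congr fine.
rewrite -[X in nu X]setIT -integral_indic//.
Qed.

(** The indicator of A is approximated simultaneously under [nu] and both translates. As A is null,
    the approximant has small second moment under [nu], and [trig_shift_le] makes its translated
    means small. *)
Lemma quasi_invariant (h : tempered R) (A : set T) : l2bounded h ->
  measurable A -> nu A = 0%E -> nu ((fun x => tadd x h) @^-1` A) = 0%E.
Proof.
move=> [c0 c00 hc0] mA nuA0.
(* The kernel inequality divides by c, and [c0] may be 0. *)
pose c := c0 + 1; have c_gt0 : 0 < c by rewrite ltr_wpDl.
have hc f : h f ^+ 2 <= c * schwartz_inner f f.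
  by rewrite (le_trans (hc0 f))// ler_wpM2r ?schwartz_inner_ge0// lerDl.
pose t1 x : T := tadd x h; pose t2 x : T := tadd x (topp h).
have m1 : measurable_fun setT t1 by exact: measurable_tadd.
have m2 : measurable_fun setT t2 by exact: measurable_tadd.
pose maps : seq (T -> T) := [:: id; t1; t2].
have mm i : measurable_fun setT (nth id maps i).
  by move: i => [|[|[|i]]] //=; rewrite nth_nil.
have mp (f : T -> T) : measurable_fun setT f -> measurable (f @^-1` A).
  by move=> mf; have := mf measurableT A mA; rewrite setTI.
pose P1 := fine (nu (t1 @^-1` A)); pose P2 := fine (nu (t2 @^-1` A)).
have P10 : 0 <= P1 by rewrite fine_ge0.
have P20 : 0 <= P2 by rewrite fine_ge0.
(* With a and b the translated means of the approximant, P1 + P2 = (a + b) + (P1 - a) + (P2 - b).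
   The factor 3 comes from squaring three terms, whose squares are at most 8 e^c e, e and e. *)
have key (e : R) : 0 < e -> (P1 + P2) ^+ 2 <= (3 * (8 * expR c + 2)) * e.
  move=> e0; have [bA /(_ _ e0)[_ [s _ <-]]] := approximable_measurable nu mm mA.
  have bf : bounded_measurable (trig s) by apply: trigonometric_bounded; exists s.
  have bAf := bounded_measurableB bA bf.
  have bt i (F : T -> R) : bounded_measurable F ->
      bounded_measurable (fun x => F (nth id maps i x)) by exact: bounded_measurable_map.
  rewrite /shifted_integral /= !big_ord_recl big_ord0 /= addr0.
  set I0 := \int[nu]_x _; set I1 := \int[nu]_x _; set I2 := \int[nu]_x _ => Ie.
  have I00 : 0 <= I0 by apply: Rintegral_ge0 => x _; exact: sqr_ge0.
  have I10 : 0 <= I1 by apply: Rintegral_ge0 => x _; exact: sqr_ge0.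
  have I20 : 0 <= I2 by apply: Rintegral_ge0 => x _; exact: sqr_ge0.
  have s1 := sqr_expectation_le nu (bt 1%N _ bAf).
  have s2 := sqr_expectation_le nu (bt 2%N _ bAf).
  rewrite /= -/I1 in s1; rewrite /= -/I2 in s2.
  have fe : \int[nu]_x (trig s x ^+ 2) <= 2 * e.
    have : \int[nu]_x (trig s x ^+ 2) <= \int[nu]_x (2 * (\1_A x - trig s x) ^+ 2 + 2 * \1_A x).
      apply: le_Rintegral => //.
      - exact/bounded_measurable_integrable/bounded_measurableX.
      - apply: bounded_measurable_integrable; apply: bounded_measurableD.
          exact/bounded_measurableZ/bounded_measurableX.
        exact: bounded_measurableZ.
      - move=> x _; have : \1_A x ^+ 2 = \1_A x :> R.
          by rewrite indicE; case: (_ \in _); rewrite ?expr1n ?expr0n.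
        have := sqr_ge0 (2 * \1_A x - trig s x); lra.
    rewrite RintegralD//; last 2 first.
    - exact/bounded_measurable_integrable/bounded_measurableZ/bounded_measurableX.
    - exact/bounded_measurable_integrable/bounded_measurableZ.
    rewrite !RintegralZl//; last 2 first.
    - exact: bounded_measurable_integrable.
    - exact/bounded_measurable_integrable/bounded_measurableX.
    rewrite (Rintegral_indic_preimage (f := id))// preimage_id nuA0 /= mulr0 addr0 -/I0; lra.
  have sh := trig_shift_le s c_gt0 hc.
  have i1 := bounded_measurable_integrable nu (bt 1%N _ bf).
  have i2 := bounded_measurable_integrable nu (bt 2%N _ bf).
  have j1 := bounded_measurable_integrable nu (bt 1%N _ bA).
  have j2 := bounded_measurable_integrable nu (bt 2%N _ bA).
  rewrite /= in i1 i2 j1 j2.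
  rewrite RintegralZl// in sh; last first.
    by apply: bounded_measurable_integrable; apply: bounded_measurableD; [exact: (bt 1%N)|exact: (bt 2%N)].
  rewrite RintegralD// in sh.
  rewrite RintegralB// (Rintegral_indic_preimage m1 mA) -/P1 in s1.
  rewrite RintegralB// (Rintegral_indic_preimage m2 mA) -/P2 in s2.
  set a := \int[nu]_x trig s (t1 x) in s1; set b := \int[nu]_x trig s (t2 x) in s2.
  rewrite -/a -/b in sh.
  have h1 : (a + b) ^+ 2 <= 8 * expR c * e.
    have : expR c * \int[nu]_x trig s x ^+ 2 <= expR c * (2 * e) by rewrite ler_pM2l ?expR_gt0.
    by move: sh; rewrite exprMn; lra.
  have := sqr_ge0 ((a + b) - (P1 - a)); have := sqr_ge0 ((a + b) - (P2 - b)).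
  have := sqr_ge0 ((P1 - a) - (P2 - b)).
  lra.
have P0 : (P1 + P2) ^+ 2 <= 0.
  apply/ler_addgt0Pr => e e0; rewrite add0r.
  pose K := 3 * (8 * expR c + 2); have K0 : 0 < K by rewrite mulr_gt0// addr_gt0// mulr_gt0 ?expR_gt0.
  by have := key _ (divr_gt0 e0 K0); rewrite -/K mulrC divfK// gt_eqF.
have P12 : P1 + P2 = 0 by apply/eqP; rewrite -sqrf_eq0 eq_le P0 sqr_ge0.
have : P1 = 0 by lra.
rewrite /P1 => E; rewrite -[LHS]fineK ?E//.
exact: fin_num_measure (mp _ m1).
Qed.

End GreyMeasure.

(** * Positivity on open sets *)

Theorem theorem2p2 (R : realType) (rho theta : R)
  (rho_gt0 : 0 < rho) (rho_lt1 : rho < 1) (theta_gt0 : 0 < theta)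
  (nu : probability (tempered_measurable R) R)
  (nu_grey : gamma_grey rho theta nu)
  (U : set (tempered R)) (U_open : open U) (U_neq0 : U !=set0) :
  (0 < nu U)%E.
Proof.
rewrite lt0e measure_ge0 andbT; apply/eqP => nuU0.
have mU := tempered_open_measurable U_open.
have [J [D [Dl2 HD]]] := l2bounded_cover U_open U_neq0.
have l2opp (x : tempered R) : l2bounded x -> l2bounded (topp x).
  by move=> [c c0 xc]; exists c => // f; rewrite toppE sqrrN.
pose B i : set (tempered_measurable R) := (fun x => tadd x (topp (D i))) @^-1` U.
(* The countable family is reindexed by the natural numbers; codes of no index give the empty
   set. *)
pose F n : set (tempered_measurable R) := if unpickle n is Some i then B i else set0.
have FU : \bigcup_n F n = setT.
  apply/seteqP; split => // y _; have [i Ui] := HD y.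
  by exists (pickle i) => //; rewrite /F pickleK.
have negF n : nu.-negligible (F n).
  rewrite /F; case: unpickle => [i|]; last exact: negligible_set0.
  apply/negligibleP; last first.
    exact: (quasi_invariant rho_gt0 rho_lt1 theta_gt0 nu_grey (l2opp _ (Dl2 i)) mU nuU0).
  rewrite -[X in measurable X]setTI; exact: measurable_tadd.
have : nu.-negligible setT by rewrite -FU; exact: negligible_bigcup.
move/(negligibleP _ measurableT) => nu0.
by have /eqP := etrans (esym (probability_setT nu)) nu0; rewrite onee_eq0.
Qed.
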